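(* Suppose that $\sum_{m=1}^\infty r(m)^{-2}<\infty$. Then, as $m\to\infty$, $$N_m/\lambda_m\longrightarrow e^{Z}\quad\text{almost surely},$$ where $$\lambda_m:=\sum_{k=0}^{m-1}e^{y_k},\qquad y_k:=\sum_{j=1}^k\frac{\delta_j}{r(j)},\qquad Z:=\sum_{k=1}^\infty\frac{\delta_k}{r(k)}(E_k-1).$$
   Context: Hiring process. $(r(m))_{m\ge0}$ is a given sequence of integers with $r(0)=1$ and $r(m)\le r(m+1)\le r(m)+1$ for all $m\ge0$ (hence $1\le r(m)\le m+1$). The values $X_1,X_2,\dots$ of the candidates are i.i.d. $\mathrm{Exp}(1)$ random variables (a.s. distinct). Candidates are examined one by one. If $m\ge0$ candidates have been accepted so far, the next candidate is accepted if and only if her value exceeds the threshold $Y_m$, where $Y_m$ is the $r(m)$-th largest of the $m$ values already accepted if $r(m)\le m$, and $Y_m:=0$ if $r(m)=m+1$ (so $Y_0=0$). $N_m$ is the index of the $m$-th accepted candidate. $\delta_k:=1$ if $r(k)=r(k-1)$ and $\delta_k:=0$ if $r(k)=r(k-1)+1$, $k\ge1$. The variables $E_k$ are defined by $E_k:=r(k)(Y_k-Y_{k-1})$ when $\delta_k=1$, and when $\delta_k=0$ they are arbitrary $\mathrm{Exp}(1)$ variables independent of everything else (these do not affect $Z$); the $E_k$ are i.i.d. $\mathrm{Exp}(1)$ and $Y_m=\sum_{k=1}^m\frac{\delta_k}{r(k)}E_k$ a.s. When $\sum_m r(m)^{-2}<\infty$ the series defining $Z$ converges a.s. *)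

(* Defs.v *)
From HB Require Import structures.
From mathcomp Require Import all_boot all_order all_algebra.
From mathcomp Require Import all_classical all_reals all_analysis.

Set Implicit Arguments.
Unset Strict Implicit.
Unset Printing Implicit Defensive.

Import Order.TTheory GRing.Theory Num.Theory.
Import numFieldNormedType.Exports.

Local Open Scope classical_set_scope.
Local Open Scope ring_scope.

Section probability_notions.
Context (d : measure_display) (T : measurableType d) (R : realType).
Variable P : probability T R.

Definition exp1_distributed (X : {RV P >-> R}) : Prop :=
  forall A : set R, measurable A -> distribution P X A = exponential_prob 1 A.

(* Mutual independence of the subfamily (F i)_(i in D): the product rule for
   every finite set of distinct indices in D. *)
Definition mutually_independent (I : eqType) (D : pred I)
    (F : I -> {RV P >-> R}) : Prop :=
  forall (J : seq I) (B : I -> set R),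
    uniq J -> {subset J <= D} -> (forall i, measurable (B i)) ->
    P (\bigcap_(i in [set` J]) (F i @^-1` B i)) =
    (\prod_(i <- J) P (F i @^-1` B i))%E.

End probability_notions.

(* The bool delta r k coerces to 0 or 1; it is only meaningful for k >= 1. *)
Definition delta (r : nat -> nat) (k : nat) : bool := r k == r k.-1.

(* The hiring process along one sample path x. Candidates are numbered from 1
   and x n is the value of candidate n.+1. *)
Section hiring_process.
Context (R : realType).
Variables (r : nat -> nat) (x : nat -> R).

(* s lists the values accepted so far, in any order. *)
Definition threshold (s : seq R) : R :=
  let m := size s in
  if (r m <= m)%N then nth 0 (sort (fun a b => b <= a) s) (r m).-1 else 0.

(* Values accepted among the candidates 1, ..., n. *)
Fixpoint accepted (n : nat) : seq R :=
  if n is n'.+1 then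
    let s := accepted n' in if threshold s < x n' then rcons s (x n') else s
  else [::].

(* The least n such that m of the first n candidates are accepted, i.e. the
   number of the m-th accepted candidate. If fewer than m candidates are ever
   accepted, the value is the default 0; if this happens for some m, then
   hire_index is eventually constantly 0. *)
Definition hire_index (m : nat) : nat :=
  xget 0%N [set n | size (accepted n) = m /\
                    forall i, (i < n)%N -> size (accepted i) <> m].

Definition Yvar (m : nat) : R := threshold (accepted (hire_index m)).

(* w supplies the auxiliary variables for the indices with delta r k = 0. *)
Definition Evar (w : nat -> R) (k : nat) : R :=
  if delta r k then (r k)%:R * (Yvar k - Yvar k.-1) else w k.

Definition Zvar (w : nat -> R) : R :=
  limn (fun n => \sum_(1 <= k < n.+1) (delta r k)%:R / (r k)%:R
                                        * (Evar w k - 1)).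

End hiring_process.

Definition ysum (R : realType) (r : nat -> nat) (k : nat) : R :=
  \sum_(1 <= j < k.+1) (delta r j)%:R / (r j)%:R.

Definition lambda (R : realType) (r : nat -> nat) (m : nat) : R :=
  \sum_(0 <= k < m) expR (ysum R r k).

(* The variables assumed mutually independent: all the values X n (index inl n)
   and those W k (index inr k) that enter the definition of E_k. *)
Definition XW_index (r : nat -> nat) : pred (nat + nat) :=
  fun i => match i with
           | inl _ => true
           | inr k => (0 < k)%N && ~~ delta r k
           end.

Definition XW (V : Type) (X W : nat -> V) (i : nat + nat) : V :=
  match i with inl n => X n | inr k => W k end.

(* Main.v *)
(** A candidate is hired iff fewer than r(m) of all earlier values are at least
    hers, so hiring depends only on relative ranks. Let h_i be the number of
    candidates hired among the first i, a_i the indicator that the next one is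
    hired, and T_i the current threshold. Given the earlier values, a_i has mean
    exp(-T_i); given only the earlier decisions, it has mean r(h_i)/(i+1), by
    exchangeability. Hence
      sum (a_i - exp(-T_i)) / r(h_i)   and   sum (a_i / r(h_i) - 1/(i+1))
    are martingales; as each m occurs once among the h_i with a_i = 1, both are
    bounded in L^2 by a multiple of sum r(m)^-2, and so converge almost surely.
    By subtraction, sum (exp(-T_i)/r(h_i) - 1/(i+1)) converges, and since
    exp(-T_i)/r(h_i) is nonincreasing, (i+1) exp(-T_i)/r(h_i) tends to 1: along
    i = N_m this says Y_m = log (N_m / r(m)) + o(1). The second series at i = N_m
    says that log (N_m / r(m)) - y_m converges, because
    sum_(k < m) 1/r(k) = y_m + sum_(q < r(m)) 1/q. The limit is therefore also
    that of Y_m - y_m, which is Z, and lambda_m ~ r(m) exp(y_m). *)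

Require Import Defs.
From HB Require Import structures.
From mathcomp Require Import all_boot all_order all_algebra.
From mathcomp Require Import all_classical all_reals all_analysis.
From mathcomp Require Import measurable_realfun zify ring lra.

Set Implicit Arguments.
Unset Strict Implicit.
Unset Printing Implicit Defensive.

Import Order.TTheory GRing.Theory Num.Theory.
Import numFieldNormedType.Exports.

Local Open Scope classical_set_scope.
Local Open Scope ring_scope.

(** * The hiring process in terms of ranks *)

(** The two martingales live in different filtrations: one knows the earlier values, the other only
    the earlier decisions. Both are instances of one abstract result in which the past is a family
    [A n] of sets of functions and the martingale property is orthogonality of the n-th difference
    to every bounded function in [A n], so that no conditional expectation has to be formed. In the
    smaller past the obstacle is that the rank of the newest value must be independent of the
    earlier decisions, which are themselves determined by ranks. This follows from a stronger fact:
    the decisions are independent of every symmetric function of the values. Convergence of the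
    second series has a further use: it shows that hiring never stops, so that no [hire_index] is a
    default value. Beyond the two almost sure convergences the argument is deterministic and applies
    to each path of positive values on which both series converge. *)

Section hiring_by_ranks.
Context (R : realType).
Variable r : nat -> nat.

(* [hired s] is the number of candidates hired when s lists all values seen so
   far, the latest first. *)
Fixpoint hired (s : seq R) : nat :=
  if s is y :: s' then
    ((count (fun z => (y <= z)%R) s' < r (hired s')) + hired s')%N
  else 0%N.

Definition hires (s : seq R) (y : R) : bool :=
  (count (fun z => (y <= z)%R) s < r (hired s))%N.

Fixpoint past (x : nat -> R) (n : nat) : seq R :=
  if n is n'.+1 then x n' :: past x n' else [::].

Lemma size_past x n : size (past x n) = n.
Proof. by elim: n => //= n ->. Qed.

Lemma hiredS x n :
  hired (past x n.+1) = (hires (past x n) (x n) + hired (past x n))%N.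
Proof. by []. Qed.

Lemma hired_le_size s : (hired s <= size s)%N.
Proof. by elim: s => //= y s; case: (_ < _)%N => /=; lia. Qed.

End hiring_by_ranks.

Section hiring_path.
Context (R : realType).
Variable r : nat -> nat.
Hypothesis r0 : r 0%N = 1%N.
Hypothesis r_step : forall m : nat, (r m <= r m.+1 <= (r m).+1)%N.

Lemma rank_gt0 m : (0 < r m)%N.
Proof. by elim: m => [|m ih]; [rewrite r0|case/andP: (r_step m); lia]. Qed.

Lemma rank_leS m : (r m <= m.+1)%N.
Proof. by elim: m => [|m ih]; [rewrite r0|case/andP: (r_step m); lia]. Qed.

Lemma rank_nondecreasing : {homo r : m n / (m <= n)%N}.
Proof.
move=> m n /subnK <-; elim: (n - m)%N => // k ih.
by rewrite addSn (leq_trans ih)//; case/andP: (r_step (k + m)).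
Qed.

(** In a nonincreasing list the entries at least [y] form an initial segment, so its length decides
    which positions hold values below [y]. *)
Lemma nth_sorted_lt (t : seq R) (k : nat) (y : R) :
  sorted (fun a b => b <= a) t -> (k < size t)%N ->
  (nth 0 t k < y) = (count (fun z => (y <= z)%R) t <= k)%N.
Proof.
have tr : transitive (fun a b : R => b <= a).
  by move=> a b c ab bc; exact: le_trans bc ab.
elim: t k => // a t ih k /= at_ kt.
have [ya|ay] := leP y a.
  case: k kt => [_|k kt] /=; first by rewrite ltNge ya.
  by rewrite add1n ltnS ih//; exact: path_sorted at_.
have c0 : count (fun z => (y <= z)%R) t = 0%N.
  apply/eqP; rewrite -leqn0 leqNgt -has_count; apply/hasPn => z zt.
  rewrite -ltNge; apply: le_lt_trans ay.
  by have /allP/(_ z zt) := order_path_min tr at_.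
rewrite c0 /=; case: k kt => [|k] kt //=.
apply: le_lt_trans ay.
by have /allP/(_ _ (mem_nth 0 kt)) := order_path_min tr at_.
Qed.

(** Positivity of [y] makes the default threshold 0 agree with the count: if the rank exceeds the
    number of values, both sides hold. *)
Lemma threshold_lt (s : seq R) (y : R) : 0 < y ->
  (threshold r s < y) = (count (fun z => (y <= z)%R) s < r (size s))%N.
Proof.
move=> y0; rewrite /threshold; case: ifPn => [rs|].
  have rk := rank_gt0 (size s).
  rewrite nth_sorted_lt.
  - have /seq.permP -> := permEl (perm_sort (fun a b : R => b <= a) s).
    by rewrite -{2}(prednK rk) ltnS.
  - by apply: sort_sorted => a b; exact: ge_total.
  - by rewrite size_sort; lia.
rewrite -ltnNge y0 => rs; apply/esym.
by rewrite (leq_ltn_trans (count_size _ _)).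
Qed.

Lemma threshold_ge0 (s : seq R) : all (fun z => 0 < z) s -> 0 <= threshold r s.
Proof.
move=> /allP s0; rewrite /threshold; case: ifPn => // rs.
have [k|k] := ltnP (r (size s)).-1 (size s).
  by apply/ltW/s0; rewrite -(mem_sort (fun a b => b <= a)) mem_nth// size_sort.
by rewrite nth_default// size_sort.
Qed.

Variable x : nat -> R.
Hypothesis x_gt0 : forall n, 0 < x n.

Local Notation acc := (accepted r x).
Local Notation T n := (threshold r (acc n)).

Lemma accepted_gt0 n : all (fun z => 0 < z) (acc n).
Proof.
elim: n => //= n ih; case: ifP => // _.
by rewrite all_rcons ih x_gt0.
Qed.

Lemma threshold_accepted_ge0 n : 0 <= T n.
Proof. exact/threshold_ge0/accepted_gt0. Qed.

Lemma count_accepted (p : pred R) n : T n < x n ->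
  count p (acc n.+1) = (p (x n) + count p (acc n))%N.
Proof. by move=> h; rewrite /= h -cats1 count_cat /= addn0 addnC. Qed.

Lemma size_acceptedS n : size (acc n.+1) = ((T n < x n)%R + size (acc n))%N.
Proof. by rewrite /=; case: ifP => h; rewrite ?size_rcons. Qed.

(** A hire adds one value above the threshold while the rank grows by at most one. If the threshold
    dropped, fewer old values than the old rank would be at least [T n], which says [T n < T n]. *)
Lemma threshold_acceptedS n : T n <= T n.+1.
Proof.
have [h|h] := ltP (T n) (x n); last by rewrite /= ltNge h.
rewrite leNgt; apply/negP => lt.
have T0 : 0 < T n by apply: le_lt_trans lt; exact: threshold_accepted_ge0.
move: (lt); rewrite threshold_lt// count_accepted// size_acceptedS h ltW//.
move=> h1.
have := ltxx (T n); rewrite {1}threshold_lt// => /negbT; rewrite -leqNgt => h2.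
case/andP: (r_step (size (acc n))); move: h1 h2; rewrite /= !add1n; lia.
Qed.

Lemma threshold_accepted_nondecreasing m n : (m <= n)%N -> T m <= T n.
Proof.
move=> /subnK <-; elim: (n - m)%N => // k ih.
by rewrite addSn (le_trans ih)// threshold_acceptedS.
Qed.

Lemma count_accepted_past y n : T n < y ->
  count (fun z => (y <= z)%R) (acc n) = count (fun z => (y <= z)%R) (past x n).
Proof.
elim: n => // n ih lty.
have ty : T n < y by apply: le_lt_trans lty; exact: threshold_acceptedS.
rewrite [RHS]/= -ih//.
have [h|h] := ltP (T n) (x n); first by rewrite count_accepted.
by rewrite /= ltNge h /= leNgt (le_lt_trans h ty).
Qed.

Lemma count_accepted_le (p : pred R) n :
  (count p (acc n) <= count p (past x n))%N.
Proof.
elim: n => // n ih.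
have [h|h] := ltP (T n) (x n); first by rewrite count_accepted//= leq_add2l.
by rewrite /= ltNge h /= (leq_trans ih)// leq_addl.
Qed.

(* A rejected value lies below the current, hence every later, threshold: above
   the threshold the accepted values are all the values seen so far. *)
Lemma threshold_lt_hires n y : size (acc n) = hired r (past x n) -> 0 < y ->
  (T n < y) = hires r (past x n) y.
Proof.
move=> sn y0; rewrite /hires -sn.
have [h|h] := ltP (T n) y.
  by move: (h); rewrite threshold_lt// count_accepted_past.
apply/esym/negbTE; rewrite -leqNgt.
rewrite (leq_trans _ (count_accepted_le _ _))//.
by rewrite leqNgt -threshold_lt// -leNgt.
Qed.

Lemma size_accepted n : size (acc n) = hired r (past x n).
Proof.
elim: n => // n ih; rewrite size_acceptedS threshold_lt_hires//.
by rewrite hiredS ih.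
Qed.

Lemma hires_threshold n y : 0 < y -> hires r (past x n) y = (T n < y).
Proof. by move=> y0; rewrite threshold_lt_hires// size_accepted. Qed.

(** The number of accepted values at least [y] rises by at most one while the rank rises by exactly
    one, so every positive [y] above the old threshold is above the new one. *)
Lemma threshold_rank_incr n : T n < x n ->
  ~~ delta r (size (acc n)).+1 -> T n.+1 = T n.
Proof.
move=> h; rewrite /delta /= => nd.
have key y : 0 < y -> T n < y -> T n.+1 < y.
  move=> y0; rewrite (threshold_lt (acc n) y0) (threshold_lt (acc n.+1) y0).
  rewrite count_accepted// size_acceptedS h add1n; set k := count _ (acc n).
  case/andP: (r_step (size (acc n))) => r1 r2 c; move: nd.
  by case: (y <= x n)%R; rewrite ?add1n ?add0n; lia.
apply/eqP; rewrite eq_le threshold_acceptedS andbT leNgt; apply/negP => lt.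
have T0 : 0 < T n.+1 by apply: le_lt_trans lt; exact: threshold_accepted_ge0.
by have := key _ T0 lt; rewrite ltxx.
Qed.

Lemma size_accepted_mono : {homo (fun n => size (acc n)) : m n / (m <= n)%N}.
Proof.
move=> m n /subnK <-; elim: (n - m)%N => // k ih.
by rewrite addSn size_acceptedS (leq_trans ih)// leq_addl.
Qed.

Lemma accepted_eq m n : (m <= n)%N -> size (acc m) = size (acc n) ->
  acc m = acc n.
Proof.
move=> /subnK <-; elim: (n - m)%N => // k ih.
rewrite addSn => e.
have h1 : (size (acc m) <= size (acc (k + m)))%N.
  exact: size_accepted_mono (leq_addl k m).
have := size_acceptedS (k + m); rewrite -e.
case: ltP => h; rewrite ?add1n ?add0n => h2; first by rewrite h2 ltnn in h1.
by rewrite [RHS]/= ltNge h; apply: ih.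
Qed.

(** This keeps [hire_index] away from its default value 0. *)
Hypothesis hire_all : forall m, exists n, size (acc n) = m.

Local Notation N := (hire_index r x).

Lemma hire_indexP m : size (acc (N m)) = m /\
  forall i, (i < N m)%N -> size (acc i) <> m.
Proof.
rewrite /hire_index; apply: (@xgetPex _ 0%N [set n | size (acc n) = m /\
  forall i, (i < n)%N -> size (acc i) <> m]).
have ex : exists n, size (acc n) == m by have [n /eqP] := hire_all m; exists n.
exists (ex_minn ex); case: ex_minnP => n /eqP nm mn; split => // i lin im.
by have := mn i; rewrite im eqxx leqNgt lin => /(_ isT).
Qed.

Lemma size_hire_index m : size (acc (N m)) = m.
Proof. by have [] := hire_indexP m. Qed.

Lemma hire_index_min m n : size (acc n) = m -> (N m <= n)%N.
Proof.
by move=> nm; rewrite leqNgt; apply/negP => /(hire_indexP m).2; exact.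
Qed.

Lemma hire_index_ge m : (m <= N m)%N.
Proof.
rewrite -{1}(size_hire_index m) size_accepted.
by rewrite (leq_trans (hired_le_size _ _))// size_past.
Qed.

Lemma Yvar0 : Yvar r x 0%N = 0.
Proof.
rewrite /Yvar; have -> : N 0%N = 0%N.
  by apply/eqP; rewrite -leqn0 hire_index_min.
by rewrite /threshold /= r0.
Qed.

Lemma YvarS m : ~~ delta r m.+1 -> Yvar r x m.+1 = Yvar r x m.
Proof.
rewrite /Yvar => nd.
have := size_hire_index m.+1; have := (hire_indexP m.+1).2.
case E : (N m.+1) => [//|n] mi sn1.
have := size_acceptedS n; rewrite sn1.
case: ltP => h; rewrite ?add1n ?add0n; last first.
  by move=> e; have := mi n (ltnSn _); rewrite e.
(* Nobody is hired between [N m] and [n], so the threshold at the next hire is still computed from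
   the list of time [N m]. *)
move=> [e]; have e' : acc n = acc (N m).
  apply/esym/accepted_eq; first by rewrite hire_index_min.
  by rewrite size_hire_index.
by rewrite threshold_rank_incr// ?e'// size_hire_index.
Qed.

(** The sum telescopes. If the rank stays, the factor [r k] cancels and leaves the increment of
    [Yvar] minus that of [ysum]; if it rises, the term and both increments vanish. *)
Lemma Zvar_partial_sum (w : nat -> R) m :
  \sum_(1 <= k < m.+1) (delta r k)%:R / (r k)%:R * (Evar r x w k - 1) =
  Yvar r x m - ysum R r m.
Proof.
elim: m => [|m ih].
  by rewrite /ysum !big_geq// Yvar0 subr0.
rewrite /ysum in ih *.
rewrite big_nat_recr//= ih [in RHS]big_nat_recr//= /Evar.
have [d|nd] := boolP (delta r m.+1); last first.
  by rewrite YvarS// !mul0r !addr0.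
have rn0 : (r m.+1)%:R != 0 :> R by rewrite pnatr_eq0 -lt0n rank_gt0.
by rewrite mul1r mulrBr mulKf// mulr1 opprD /=; lra.
Qed.

End hiring_path.

(** * Limits of real sequences *)

Section real_sequences.
Context (R : realType).
Implicit Types (a b c q u : nat -> R).

Lemma cvg_series_small u (e : R) : cvgn (series u) -> 0 < e ->
  exists n0, forall m n, (n0 <= m)%N -> (m <= n)%N ->
    `|\sum_(m <= i < n) u i| <= e.
Proof.
move=> cu e0.
have /cvgrPdist_le/(_ (e / 2)) := cu.
rewrite divr_gt0// => /(_ isT) [n0 _ hn0].
exists n0 => m n n0m mn.
have -> : \sum_(m <= i < n) u i = series u n - series u m.
  rewrite /series /= [X in X - _](big_cat_nat (n := m))//=.
  by rewrite [X in X - _]addrC addrK.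
have h1 := hn0 m n0m; have h2 := hn0 n (leq_trans n0m mn).
rewrite (_ : series u n - series u m =
  (limn (series u) - series u m) - (limn (series u) - series u n)); last by lra.
by apply: (le_trans (ler_normB _ _)); move: h1 h2 => /=; lra.
Qed.

(* Monotonicity replaces a block sum of q by its extreme term. *)
Lemma nonincreasing_harmonic q : {homo q : m n / (m <= n)%N >-> n <= m} ->
  cvgn (series (fun i => q i - i.+1%:R^-1)) ->
  n.+1%:R * q n @[n --> \oo] --> (1 : R).
Proof.
move=> q_dec cq; apply/cvgrPdist_le => e e0.
(* Blocks will have length [d = n %/ K]. With [N = n.+1] this gives [d * (2 + 2 / e) <= N], which
   keeps the harmonic sums over the blocks before and after [n] within factors [1 + e / 2] and
   [1 - e / 2] of [d / N]. *)
have [K Ke] : exists K : nat, 2 + 2 / e <= K%:R.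
  exists (Num.truncn (2 + 2 / e)).+1.
  have d0 : 0 <= 2 + 2 / e by rewrite addr_ge0// divr_ge0// ltW.
  by have /andP[_ /ltW] := truncn_itv d0.
have ie : e * e^-1 = 1 by rewrite mulfV// gt_eqF.
have ei0 : 0 < e^-1 by rewrite invr_gt0.
have K2 : 2 <= K%:R :> R by lra.
have K0 : (0 < K)%N by rewrite -(ltr0n R); lra.
(* The error of a block sum gets divided by [d / N], which is at least [1 / (2 * K)]; this tolerance
   then costs [e / 2]. *)
have eta0 : 0 < e / (4 * K%:R) by rewrite divr_gt0// mulr_gt0//; lra.
have [n0 hn0] := cvg_series_small cq eta0.
set eta := e / (4 * K%:R) in eta0 hn0.
have etaK : eta * K%:R = e / 4.
  by rewrite /eta invfM !mulrA mulfVK// gt_eqF//; lra.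
have big : forall m n, (n0 <= m)%N -> (m <= n)%N ->
    (n - m)%:R * q m >= \sum_(m <= i < n) q i /\
    (n - m)%:R * q n <= \sum_(m <= i < n) q i.
  move=> m n _ mn; rewrite -!sumr_const_nat !mulr_suml; split.
    rewrite big_nat_cond [leRHS]big_nat_cond.
    by apply: ler_sum => i /andP[/andP[mi im] _]; rewrite mul1r q_dec.
  rewrite big_nat_cond [leRHS]big_nat_cond.
  by apply: ler_sum => i /andP[/andP[mi im] _]; rewrite mul1r q_dec// ltnW.
have har : forall m n, (m <= n)%N ->
    (n - m)%:R / n.+1%:R <= \sum_(m <= i < n) (i.+1%:R^-1 : R) /\
    \sum_(m <= i < n) (i.+1%:R^-1 : R) <= (n - m)%:R / m.+1%:R.
  move=> m n mn; rewrite -!sumr_const_nat !mulr_suml; split.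
    rewrite big_nat_cond [leRHS]big_nat_cond.
    apply: ler_sum => i /andP[/andP[mi im] _].
    by rewrite mul1r lef_pV2 ?posrE// ler_nat; lia.
  rewrite big_nat_cond [leRHS]big_nat_cond.
  apply: ler_sum => i /andP[/andP[mi im] _].
  by rewrite mul1r lef_pV2 ?posrE// ler_nat; lia.
near=> n.
pose d := (n %/ K)%N.
have nK : (K <= n)%N by near: n; exact: nbhs_infty_ge.
have nn0 : (2 * n0 <= n)%N by near: n; exact: nbhs_infty_ge.
have d0 : (0 < d)%N by rewrite divn_gt0.
have dn : (d * K <= n)%N := leq_divM _ _.
have nd : (n < d.+1 * K)%N by rewrite ltn_ceil.
have K2' : (2 <= K)%N by rewrite -(ler_nat R).
have d2n : (2 * d <= n)%N by nia.
have d0R : 0 < d%:R :> R by rewrite ltr0n.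
have dnR : d%:R * K%:R <= n%:R :> R by rewrite -natrM ler_nat.
have ndR : n%:R + 1 <= 2 * (K%:R * d%:R) :> R.
  have -> : n%:R + 1 = n.+1%:R :> R by rewrite -natr1.
  by rewrite -!natrM ler_nat; nia.
(* The terms of the block ending at [n] are at least [q n]; those of the block starting at [n], used
   for [lo], are at most [q n]. *)
have up : d%:R * q n <= eta + d%:R / (n%:R + 1 - d%:R).
  have ld : (n0 <= n - d)%N by lia.
  have [_] := big _ _ ld (leq_subr d n).
  have := hn0 _ _ ld (leq_subr d n).
  have [_] := har _ _ (leq_subr d n).
  rewrite sumrB subKn ?leq_div// -[(n - d).+1%:R]natr1 natrB ?leq_div//.
  rewrite -addrAC => h1 /ler_normlP[_ h2] h3; lra.
have lo : d%:R / (n%:R + 1 + d%:R) - eta <= d%:R * q n.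
  have nn : (n0 <= n)%N by lia.
  have [+ _] := big _ _ nn (leq_addr d n).
  have := hn0 _ _ nn (leq_addr d n).
  have [+ _] := har _ _ (leq_addr d n).
  rewrite sumrB addKn -[(n + d).+1%:R]natr1 natrD.
  rewrite addrAC => h1 /ler_normlP[h2 _] h3; lra.
set N := n%:R + 1 in up lo ndR.
have -> : n.+1%:R = N by rewrite /N natr1.
have dN : d%:R * (2 + 2 / e) <= N.
  have : d%:R * (2 + 2 / e) <= d%:R * K%:R by rewrite ler_pM2l.
  by rewrite /N; lra.
have de : d%:R * (2 * e + 2) <= N * e.
  have : d%:R * (2 + 2 / e) * e <= N * e by rewrite ler_pM2r.
  by rewrite -mulrA mulrDl mulfVK ?gt_eqF.
have de0 : 0 <= d%:R * e by rewrite mulr_ge0// ltW.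
have N0 : 0 < N by rewrite /N ltr_wpDl.
have Nd0 : 0 < N - d%:R.
  have : (2 * d)%:R <= n%:R :> R by rewrite ler_nat.
  by rewrite /N natrM; lra.
have Nd0' : 0 < N + d%:R by lra.
have dN1 : N / (N - d%:R) <= 1 + e / 2.
  by rewrite ler_pdivrMr//; lra.
have dN2 : 1 - e / 2 <= N / (N + d%:R).
  by rewrite ler_pdivlMr//; lra.
have Neta : N * eta <= (e / 2) * d%:R.
  have : N * eta <= 2 * (K%:R * d%:R) * eta by rewrite ler_pM2r.
  have -> : 2 * (K%:R * d%:R) * eta = 2 * d%:R * (eta * K%:R) by ring.
  by rewrite etaK; lra.
have up' : d%:R * (N * q n) <= d%:R * (1 + e).
  have : N * (d%:R * q n) <= N * (eta + d%:R / (N - d%:R)) by rewrite ler_pM2l.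
  have : d%:R * (N / (N - d%:R)) <= d%:R * (1 + e / 2) by rewrite ler_pM2l.
  rewrite mulrDr !mulrA (mulrC N d%:R); lra.
have lo' : d%:R * (1 - e) <= d%:R * (N * q n).
  have : N * (d%:R / (N + d%:R) - eta) <= N * (d%:R * q n) by rewrite ler_pM2l.
  have : d%:R * (1 - e / 2) <= d%:R * (N / (N + d%:R)) by rewrite ler_pM2l.
  rewrite mulrBr !mulrA (mulrC N d%:R); lra.
rewrite !ler_pM2l// in up' lo'.
by apply/ler_normlP; split; lra.
Unshelve. all: by end_near. Qed.

(** The limit is Euler's constant. The sequence is nondecreasing, and its increments are at most
    those of [- 1 / n.+1], which telescope to a bound by 1. *)
Lemma is_cvg_harmonic_sub_ln :
  cvgn (fun n => \sum_(0 <= k < n) (k.+1%:R^-1 : R) - ln n.+1%:R).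
Proof.
set u := (X in cvgn X).
have step n : u n <= u n.+1 /\ u n.+1 - u n <= n.+1%:R^-1 - n.+2%:R^-1.
  have a0 : 0 < n.+1%:R :> R by rewrite ltr0n.
  have b0 : 0 < n.+2%:R :> R by rewrite ltr0n.
  have ab : n.+2%:R = n.+1%:R + 1 :> R by rewrite natr1.
  have e : u n.+1 - u n = n.+1%:R^-1 - (ln n.+2%:R - ln n.+1%:R).
    by rewrite /u big_nat_recr//=; ring.
  have l1 : ln n.+2%:R - ln n.+1%:R <= n.+1%:R^-1 :> R.
    rewrite -ln_div ?posrE//.
    have -> : n.+2%:R / n.+1%:R = 1 + n.+1%:R^-1 :> R.
      by rewrite ab mulrDl mul1r divff// gt_eqF.
    apply: le_ln1Dx; apply: (lt_trans (ltrN10 _)).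
    by rewrite invr_gt0.
  have l2 : ln n.+1%:R - ln n.+2%:R <= - n.+2%:R^-1 :> R.
    rewrite -ln_div ?posrE//.
    have -> : n.+1%:R / n.+2%:R = 1 + - n.+2%:R^-1 :> R.
      have -> : n.+1%:R = n.+2%:R - 1 :> R by rewrite ab addrK.
      by rewrite mulrBl mul1r divff// gt_eqF.
    by apply: le_ln1Dx; rewrite ltrN2 invf_lt1// ltr1n.
  rewrite e -subr_ge0 e; split; first by rewrite subr_ge0.
  by rewrite lerD2l lerN2 -lerN2 opprB.
apply: nondecreasing_is_cvgn.
  by apply/nondecreasing_seqP => n; have [] := step n.
exists 1 => _ [n _ <-].
suff : u n <= 1 - n.+1%:R^-1.
  by move=> h; apply: (le_trans h); rewrite gerBl invr_ge0.
elim: n => [|n ih]; last first.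
  have [_] := step n; move: ih.
  by move: (u n) (u n.+1) (n.+1%:R^-1) (n.+2%:R^-1) => ? ? ? ?; lra.
by rewrite /u big_geq// ln1 invr1; lra.
Qed.

(** Cesaro means with weights [a]: the head is negligible against the diverging total weight, and
    the tail is an average of small terms. *)
Lemma cvg_weighted_mean a c : (forall k, 0 < a k) ->
  series a @ \oo --> +oo -> c @ \oo --> (0 : R) ->
  (\sum_(0 <= k < m) a k * c k) / series a m @[m --> \oo] --> (0 : R).
Proof.
move=> a0 ay c0; apply/cvgrPdist_le => e e0.
have e20 : 0 < e / 2 by rewrite divr_gt0.
have /cvgrPdist_le/(_ _ e20) [n0 _ hn0] := c0.
pose C := \sum_(0 <= k < n0) a k * `|c k|.
have C0 : 0 <= C by apply: sumr_ge0 => k _; rewrite mulr_ge0// ltW.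
near=> m.
have n0m : (n0 <= m)%N by near: m; exact: nbhs_infty_ge.
(* The [+ 1] makes the total weight positive even if [C] is 0. *)
have am : (C + 1) * (2 / e) <= series a m.
  by near: m; move/cvgryPge: ay; exact.
have s0 : 0 < series a m.
  by apply: lt_le_trans am; rewrite mulr_gt0// ?divr_gt0//; lra.
rewrite sub0r normrN normrM normfV (gtr0_norm s0) ler_pdivrMr//.
apply: (le_trans (ler_norm_sum _ _ _)).
rewrite (eq_bigr (fun k => a k * `|c k|)); last first.
  by move=> k _; rewrite normrM gtr0_norm.
rewrite (big_cat_nat (n := n0))//= -/C.
have h1 : \sum_(n0 <= k < m) a k * `|c k| <= (e / 2) * series a m.
  apply: (@le_trans _ _ (\sum_(n0 <= k < m) a k * (e / 2))).
    rewrite big_nat_cond [leRHS]big_nat_cond.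
    apply: ler_sum => k /andP[/andP[nk _] _]; rewrite ler_pM2l//.
    by have := hn0 k nk; rewrite sub0r normrN.
  rewrite -mulr_suml mulrC ler_pM2l// /series /= [leRHS](big_cat_nat (n := n0))//=.
  by rewrite lerDr sumr_ge0// => k _; rewrite ltW.
have h2 : C <= (e / 2) * series a m.
  have : (e / 2) * ((C + 1) * (2 / e)) <= (e / 2) * series a m by rewrite ler_pM2l.
  have -> : (e / 2) * ((C + 1) * (2 / e)) = C + 1.
    by rewrite mulrCA -[e / 2]invf_div mulVf ?mulr1// gt_eqF// divr_gt0.
  by lra.
by apply: (le_trans (lerD h2 h1)); lra.
Unshelve. all: by end_near. Qed.

(** A form of the Stolz-Cesaro theorem, [c] being the relative error between the increments of [b]
    and the terms [a]. *)
Lemma cvg_ratio_series a b c : (forall k, 0 < a k) ->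
  series a @ \oo --> +oo -> c @ \oo --> (0 : R) ->
  (forall k, b k.+1 - b k = a k * (1 + c k)) ->
  b m / series a m @[m --> \oo] --> (1 : R).
Proof.
move=> a0 ay c0 bS.
have bE m : b m = b 0%N + (series a m + \sum_(0 <= k < m) a k * c k).
  elim: m => [|m ih]; first by rewrite /series /= !big_geq// !addr0.
  rewrite -[LHS](subrK (b m)) bS {}ih /series /= !big_nat_recr//=; lra.
have : b 0%N * (series a m)^-1 + (1 + (\sum_(0 <= k < m) a k * c k) / series a m)
    @[m --> \oo] --> b 0%N * 0 + (1 + 0).
  apply: cvgD; last by apply: cvgD; [exact: cvg_cst|exact: cvg_weighted_mean].
  apply: cvgM; first exact: cvg_cst.
  apply/gtr0_cvgV0; last exact: ay.
  by near=> m; near: m; move/cvgryPgt: ay; exact.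
rewrite mulr0 add0r addr0; apply: cvg_trans; apply: near_eq_cvg; near=> m.
rewrite (bE m) !mulrDl divff// gt_eqF//.
by near: m; move/cvgryPgt: ay; exact.
Unshelve. all: by end_near. Qed.

End real_sequences.

(** * Convergence along a sample path *)

Section ranks.
Context (R : realType).
Variable r : nat -> nat.
Hypothesis r0 : r 0%N = 1%N.
Hypothesis r_step : forall m : nat, (r m <= r m.+1 <= (r m).+1)%N.

Lemma ysumS m : ysum R r m.+1 = ysum R r m + (delta r m.+1)%:R / (r m.+1)%:R.
Proof. by rewrite /ysum [LHS]big_nat_recr. Qed.

Lemma ysum_ge0 m : 0 <= ysum R r m.
Proof. by apply: sumr_ge0 => k _; rewrite divr_ge0. Qed.

(* The ranks omitted from [ysum] are those k with [r k = (r k.-1).+1]; their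
   reciprocals make up a harmonic sum. *)
Lemma sum_inv_rank m : \sum_(0 <= k < m) ((r k)%:R^-1 : R) =
  ysum R r m + \sum_(0 <= k < (r m).-1) k.+1%:R^-1.
Proof.
elim: m => [|m ih]; first by rewrite r0 /ysum !big_geq// addr0.
have rm := rank_gt0 r0 r_step m.
rewrite big_nat_recr//= ih ysumS /delta /=.
have [->|ne] := eqVneq (r m.+1) (r m); first by rewrite mul1r addrAC.
have -> : r m.+1 = (r m).+1 by case/andP: (r_step m); lia.
rewrite mul0r addr0 -addrA; congr (_ + _).
by rewrite -{2 3}(prednK rm) /= big_nat_recr.
Qed.

Hypothesis r_infty : r m @[m --> \oo] --> \oo.

Lemma cvg_inv_rank : ((r m)%:R^-1 : R) @[m --> \oo] --> (0 : R).
Proof.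
apply/gtr0_cvgV0.
  by near=> m; rewrite ltr0n; exact: rank_gt0.
apply/cvgryPge => A; near=> m.
have [A0|A0] := leP A 0; first exact: le_trans A0 _.
have /andP[_ /ltW/le_trans->//] := truncn_itv (ltW A0).
rewrite ler_nat; near: m; move: r_infty => /cvgnyPge; exact.
Unshelve. all: by end_near. Qed.

Lemma lambda_infty : lambda R r @ \oo --> +oo.
Proof.
have mle m : m%:R <= lambda R r m.
  rewrite /lambda -[m in m%:R]subn0 -sumr_const_nat ler_sum// => k _.
  by rewrite -[leLHS]expR0 ler_expR ysum_ge0.
apply/cvgryPge => A; near=> m; apply: le_trans (mle m).
near: m; exact: nbhs_infty_ger.
Unshelve. all: by end_near. Qed.

(** The increments of [r m * expR (y m)] are compared with the terms [expR (y m)] of [lambda]. If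
    the rank rises by one, [y] does not move and they agree; if the rank stays at [r], the increment
    is [r * (expR (1 / r) - 1)] times the term, a factor tending to 1. *)
Lemma cvg_rank_lambda :
  (r m)%:R * expR (ysum R r m) / lambda R r m @[m --> \oo] --> (1 : R).
Proof.
pose c k : R := (delta r k.+1)%:R *
  ((r k.+1)%:R * (expR (r k.+1)%:R^-1 - 1) - 1).
apply: (@cvg_ratio_series _ (fun k => expR (ysum R r k))
  (fun m => (r m)%:R * expR (ysum R r m)) c).
- by move=> k; exact: expR_gt0.
- exact: lambda_infty.
- have ir := cvg_inv_rank; rewrite -(cvg_shiftS (fun m => (r m)%:R^-1 : R)) in ir.
  have ir2 : 2 * (r m.+1)%:R^-1 @[m --> \oo] --> (0 : R).
    by rewrite -[X in _ --> X](mulr0 2); apply: cvgM ir; exact: cvg_cst.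
  apply: (squeeze_cvgr _ (cvg_cst 0) ir2); near=> k.
  have r2 : (2 <= r k.+1)%N.
    rewrite (leq_trans _ (rank_nondecreasing r_step (leqnSn k)))//.
    by near: k; move: r_infty => /cvgnyPge; exact.
  set t : R := (r k.+1)%:R^-1.
  have r2R : 2 <= (r k.+1)%:R :> R by rewrite ler_nat.
  have rk0 : 0 < (r k.+1)%:R :> R by lra.
  have rt : (r k.+1)%:R * t = 1 by rewrite mulfV// gt_eqF//; lra.
  have t0 : 0 < t by rewrite invr_gt0; lra.
  have t1 : t <= 1 / 2 by rewrite div1r lef_pV2 ?posrE//; lra.
  have e1 := expR_ge1Dx t.
  have e2 : expR t * (1 - t) <= 1.
    have := expR_ge1Dx (- t); rewrite expRN.
    by rewrite -ler_pdivlMl ?expR_gt0// mulr1.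
  have c0 : 0 <= (r k.+1)%:R * (expR t - 1) - 1.
    have : (r k.+1)%:R * t <= (r k.+1)%:R * (expR t - 1).
      by rewrite ler_pM2l//; lra.
    by rewrite rt; lra.
  have c1 : (r k.+1)%:R * (expR t - 1) - 1 <= 2 * t.
    (* This is [expR t <= 1 / (1 - t)] without the fraction: [(1 - t) * (1 + t + 2 * t * t) = 1 + t
       * t * (1 - 2 * t)], so the nonnegative products [s] and [s2] add up to the claim. *)
    have e3 : expR t - 1 <= t + 2 * t * t.
      rewrite -subr_ge0 in e2; rewrite -subr_ge0.
      have s : 0 <= (1 - expR t * (1 - t)) * (1 + t + 2 * t * t).
        by rewrite mulr_ge0// !addr_ge0 ?mulr_ge0//; lra.
      have s2 : 0 <= t * t * (1 - 2 * t) * expR t.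
        by rewrite !mulr_ge0 ?expR_ge0//; lra.
      by move: s s2; lra.
    have : (r k.+1)%:R * (expR t - 1) <= (r k.+1)%:R * (t + 2 * t * t).
      by rewrite ler_pM2l//; lra.
    have -> : (r k.+1)%:R * (t + 2 * t * t) =
        (r k.+1)%:R * t + 2 * ((r k.+1)%:R * t) * t by ring.
    by rewrite rt; lra.
  by rewrite /c; case: (delta r k.+1); rewrite ?mul1r ?mul0r; apply/andP;
    split => //; lra.
- move=> k; rewrite ysumS /c /delta /=.
  have [e|ne] := eqVneq (r k.+1) (r k).
    by rewrite e /= !mulr1n !mul1r expRD; ring.
  have -> : r k.+1 = (r k).+1 by case/andP: (r_step k); lia.
  by rewrite !mul0r !addr0 mulr1 -natr1; ring.
Unshelve. all: by end_near. Qed.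

Variable x : nat -> R.
Hypothesis x_gt0 : forall n, 0 < x n.

Local Notation h i := (hired r (past x i)).
Local Notation a i := ((hires r (past x i) (x i))%:R : R).
Local Notation T i := (threshold r (accepted r x i)).
Local Notation N := (hire_index r x).

Lemma sum_hires (g : nat -> R) n :
  \sum_(0 <= i < n) a i * g (h i) = \sum_(0 <= k < h n) g k.
Proof.
elim: n => [|n ih]; first by rewrite !big_geq.
rewrite big_nat_recr//= ih; rewrite -/(hires r (past x n) (x n)).
case: hires; rewrite ?mul1r ?mul0r ?addr0//.
by rewrite add1n big_nat_recr.
Qed.

Hypothesis cvg_rank_compensated :
  cvgn (series (fun i => a i / (r (h i))%:R - i.+1%:R^-1)).
Hypothesis cvg_threshold_compensated :
  cvgn (series (fun i => (a i - expR (- T i)) / (r (h i))%:R)).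

(** With at most [m] hires the nonnegative series of [a i / r (h i)] is bounded, hence convergent;
    subtracting the compensated series would make the harmonic series converge. *)
Lemma hired_unbounded m : exists n, (m <= h n)%N.
Proof.
apply: contrapT => /forallNP ub.
apply: (@dvg_harmonic R).
have cS : cvgn (series (fun i => a i / (r (h i))%:R)).
  apply: nondecreasing_is_cvgn.
    apply/nondecreasing_seqP => n; rewrite /series /= big_nat_recr//= lerDl.
    by rewrite divr_ge0.
  exists (\sum_(0 <= k < m) (r k)%:R^-1) => _ [n _ <-].
  rewrite /series /= (sum_hires (fun k => (r k)%:R^-1)).
  have hm : (h n <= m)%N by have := ub n; lia.
  rewrite [leRHS](big_cat_nat (n := h n))//= lerDl.
  by apply: sumr_ge0 => k _; rewrite invr_ge0.
rewrite (_ : series harmonic = series (fun i => a i / (r (h i))%:R) -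
  series (fun i => a i / (r (h i))%:R - i.+1%:R^-1)); first exact: is_cvgB.
apply/funext => n; rewrite fctE /series /= -sumrB.
by apply: eq_bigr => i _ /=; rewrite opprB addrC subrK.
Qed.

Lemma hire_all m : exists n, size (accepted r x n) = m.
Proof.
have [n] := hired_unbounded m.
elim: n => [|n ih].
  by rewrite leqn0 => /eqP m0; exists 0%N; rewrite m0.
move=> hm1; have [hm|hm] := leqP m (h n); first exact: ih.
exists n.+1; rewrite size_accepted// hiredS.
move: hm1; rewrite hiredS; case: hires; rewrite ?add1n ?add0n; lia.
Qed.


Lemma hire_index_infty : N @ \oo --> \oo.
Proof.
apply/cvgnyPge => A; near=> m.
rewrite (leq_trans _ (hire_index_ge r0 r_step x_gt0 hire_all m))//.
by near: m; exact: nbhs_infty_ge.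
Unshelve. all: by end_near. Qed.

Lemma threshold_rank_ratio :
  (N m).+1%:R * (expR (- Yvar r x m) / (r m)%:R) @[m --> \oo] --> (1 : R).
Proof.
have hm : {homo (fun i => h i) : m n / (m <= n)%N}.
  by move=> m n mn; rewrite -!size_accepted//; exact: size_accepted_mono.
have q_dec : {homo (fun i => expR (- T i) / (r (h i))%:R) :
    m n / (m <= n)%N >-> n <= m}.
  move=> m n mn; apply: ler_pM.
  - exact: expR_ge0.
  - by rewrite invr_ge0.
  - by rewrite ler_expR lerN2; exact: threshold_accepted_nondecreasing.
  - rewrite lef_pV2 ?posrE ?ltr0n ?rank_gt0// ler_nat.
    by apply: rank_nondecreasing => //; exact: hm.
have := nonincreasing_harmonic q_dec.
have cq : cvgn (series (fun i => expR (- T i) / (r (h i))%:R - i.+1%:R^-1)).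
  rewrite (_ : series _ = series (fun i => a i / (r (h i))%:R - i.+1%:R^-1) -
    series (fun i => (a i - expR (- T i)) / (r (h i))%:R)); first exact: is_cvgB.
  apply/funext => n; rewrite fctE /series /= -sumrB.
  by apply: eq_bigr => i _ /=; ring.
move=> /(_ cq)/(cvg_comp _ _ hire_index_infty); apply: cvg_trans.
apply: near_eq_cvg; near=> m => /=.
by rewrite -size_accepted// (size_hire_index hire_all).
Unshelve. all: by end_near. Qed.

Let l := - limn (series (fun i => a i / (r (h i))%:R - i.+1%:R^-1)).

(** The partial sum of the compensated series up to [N m] contains two harmonic sums, of lengths
    [(r m).-1] and [N m]. Replacing each by a logarithm costs Euler's constant, which cancels, so
    the limit is minus the sum of the series. *)
Lemma cvg_log_hire_index :
  ln (N m).+1%:R - ln (r m)%:R - ysum R r m @[m --> \oo] --> l.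
Proof.
pose H (n : nat) : R := \sum_(0 <= k < n) k.+1%:R^-1.
have /cvg_ex[g Hg] : cvgn (fun n => H n - ln n.+1%:R).
  exact: (@is_cvg_harmonic_sub_ln R).
have r1 : (r m).-1 @[m --> \oo] --> \oo.
  apply/cvgnyPge => A; near=> m.
  suff : (A < r m)%N by case: (r m).
  by near: m; move: r_infty => /cvgnyPgt; exact.
have := cvgB (cvgB (cvg_comp _ _ r1 Hg) (cvg_comp _ _ hire_index_infty Hg))
  (cvg_comp _ _ hire_index_infty cvg_rank_compensated).
rewrite subrr sub0r -/l => /(_ _ _); apply: cvg_trans.
apply: near_eq_cvg; near=> m => /=.
rewrite !fctE /series /= sumrB (sum_hires (fun k => (r k)%:R^-1)).
rewrite -size_accepted// (size_hire_index hire_all) sum_inv_rank.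
by rewrite (prednK (rank_gt0 r0 r_step m)) -/(H _) -/(H _); ring.
Unshelve. all: by end_near. Qed.

Lemma cvg_Yvar_ysum : Yvar r x m - ysum R r m @[m --> \oo] --> l.
Proof.
have c1 : ln ((N m).+1%:R * (expR (- Yvar r x m) / (r m)%:R))
    @[m --> \oo] --> (0 : R).
  rewrite -ln1; apply: (continuous_cvg _ _ threshold_rank_ratio).
  exact: continuous_ln ltr01.
have := cvgB cvg_log_hire_index c1; rewrite subr0 => /(_ _).
apply: cvg_trans; apply: near_eq_cvg; near=> m => /=.
have rm : (r m)%:R \is @Num.pos R by rewrite posrE ltr0n rank_gt0.
have Nm : (N m).+1%:R \is @Num.pos R by rewrite posrE.
have eY : expR (- Yvar r x m) \is @Num.pos R by rewrite posrE expR_gt0.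
rewrite !fctE /= lnM ?ln_div ?expRK//; first by ring.
by rewrite posrE divr_gt0 -?posrE.
Unshelve. all: by end_near. Qed.

Lemma Zvar_limit (w : nat -> R) : Zvar r x w = l.
Proof.
apply: cvg_lim => //.
rewrite (_ : (fun _ => _) = (fun m => Yvar r x m - ysum R r m)).
  exact: cvg_Yvar_ysum.
by apply/funext => m; rewrite (Zvar_partial_sum r0 r_step x_gt0 hire_all).
Qed.

Lemma hire_index_lambda (w : nat -> R) :
  (N m)%:R / lambda R r m @[m --> \oo] --> expR (Zvar r x w).
Proof.
rewrite Zvar_limit.
have e1 : expR (ln (N m).+1%:R - ln (r m)%:R - ysum R r m)
    @[m --> \oo] --> expR l.
  by apply: (continuous_cvg _ _ cvg_log_hire_index); exact: continuous_expR.
have Ny : ((N m).+1%:R^-1 : R) @[m --> \oo] --> (0 : R).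
  exact: (cvg_comp _ _ hire_index_infty (@cvg_harmonic R)).
(* The logarithmic estimate concerns [(N m).+1]; the last factor, [1 - 1 / (N m).+1], turns it into
   [N m]. *)
have := cvgM (cvgM e1 cvg_rank_lambda) (cvgB (cvg_cst (1 : R)) Ny).
rewrite subr0 !mulr1 => /(_ _ _ _ _); apply: cvg_trans.
apply: near_eq_cvg; near=> m => /=.
have rm : 0 < (r m)%:R :> R by rewrite ltr0n rank_gt0.
have Nm : 0 < (N m).+1%:R :> R by rewrite ltr0n.
rewrite !fctE /= !expRD !expRN !lnK ?posrE//.
have An : (N m).+1%:R != 0 :> R by rewrite gt_eqF.
have rn : (r m)%:R != 0 :> R by rewrite gt_eqF.
have yn : expR (ysum R r m) != 0 by rewrite gt_eqF// expR_gt0.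
rewrite (_ : 1 - (N m).+1%:R^-1 = (N m)%:R / (N m).+1%:R :> R); last first.
  by rewrite -[in (N m)%:R](addrK 1 (N m)%:R) natr1 mulrBl divff// mul1r.
move: (lambda R r m)^-1 => L; move: An; move: (N m).+1%:R => A An; field.
by rewrite An rn yn.
Unshelve. all: by end_near. Qed.

End ranks.

(** * Martingales bounded in L2 *)

Section bounded_measurable.
Context d (T : measurableType d) (R : realType) (P : probability T R).
Implicit Types f g : T -> R.

(** A class closed under sums and products on which all integrals are finite, so that linearity
    applies freely. *)
Definition bounded_measurable f :=
  measurable_fun setT f /\ exists M, forall w, `|f w| <= M.

Local Notation bmf := bounded_measurable.
Local Notation E f := (\int[P]_w f w).

Lemma bounded_measurable_integrable f : bmf f ->
  P.-integrable setT (EFin \o f).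
Proof.
move=> [mf [M fM]]; apply: measurable_bounded_integrable => //.
  by rewrite -ge0_fin_numE ?measure_ge0// fin_num_measure.
exists M; split; first exact: num_real.
by move=> y My w _; exact: le_trans (fM w) (ltW My).
Qed.

Lemma bounded_measurable_cst c : bmf (fun=> c).
Proof. by split; [exact: measurable_cst|exists `|c|]. Qed.

Lemma bounded_measurableD f g : bmf f -> bmf g -> bmf (fun w => f w + g w).
Proof.
move=> [mf [M fM]] [mg [L gL]]; split; first exact: measurable_funD.
by exists (M + L) => w; apply: le_trans (ler_normD _ _) _; exact: lerD.
Qed.

Lemma bounded_measurableM f g : bmf f -> bmf g -> bmf (fun w => f w * g w).
Proof.
move=> [mf [M fM]] [mg [L gL]]; split; first exact: measurable_funM.
by exists (M * L) => w; rewrite normrM; exact: ler_pM.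
Qed.

Lemma bounded_measurable_bool (b : T -> bool) : measurable_fun setT b ->
  bmf (fun w => (b w)%:R).
Proof.
move=> mb; split.
  rewrite (_ : (fun w => (b w)%:R) = (fun w => if b w then 1 else 0 : R)).
    exact: measurable_fun_ifT.
  by apply/funext => w; case: (b w).
by exists 1 => w; case: (b w); rewrite ?normr1 ?normr0.
Qed.

Lemma le_Rintegral_bounded f g : bmf f -> bmf g ->
  (forall w, f w <= g w) -> E f <= E g.
Proof.
move=> bf bg fg; apply: le_Rintegral => //.
- exact: bounded_measurable_integrable.
- exact: bounded_measurable_integrable.
Qed.

Lemma RintegralD_bounded f g : bmf f -> bmf g ->
  E (fun w => f w + g w) = E f + E g.
Proof.
by move=> bf bg; apply: RintegralD => //; exact: bounded_measurable_integrable.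
Qed.

Lemma RintegralZl_bounded c f : bmf f -> E (fun w => c * f w) = c * E f.
Proof.
by move=> bf; apply: RintegralZl => //; exact: bounded_measurable_integrable.
Qed.

Lemma RintegralB_bounded f g : bmf f -> bmf g ->
  E (fun w => f w - g w) = E f - E g.
Proof.
by move=> bf bg; apply: RintegralB => //; exact: bounded_measurable_integrable.
Qed.

Lemma Rintegral_sum_bounded (I : Type) (s : seq I) (F : I -> T -> R) :
  (forall i, bmf (F i)) ->
  bmf (fun w => \sum_(i <- s) F i w) /\
  E (fun w => \sum_(i <- s) F i w) = \sum_(i <- s) E (F i).
Proof.
move=> bF; elim: s => [|i s [bs Es]].
  rewrite big_nil; under [X in bmf X]eq_fun do rewrite big_nil.
  under eq_Rintegral do rewrite big_nil.
  by rewrite Rintegral_cst// mul0r; split => //; exact: bounded_measurable_cst.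
under [X in bmf X]eq_fun do rewrite big_cons.
under eq_Rintegral do rewrite big_cons.
rewrite RintegralD_bounded// Es big_cons; split => //.
exact: bounded_measurableD.
Qed.

(** Chebyshev: [c ^+ 2] times the indicator of the event is at most [f ^+ 2]. *)
Lemma probability_le_square f (c : R) : bmf f -> 0 < c ->
  (P [set w | (c <= `|f w|)%R] <= ((E (fun w => f w ^+ 2) / c ^+ 2)%R)%:E)%E.
Proof.
move=> bf c0; have [mf _] := bf.
have mA : measurable_fun setT (fun w => c <= `|f w|).
  by apply: measurable_fun_ler => //; exact: measurableT_comp.
have bA := bounded_measurable_bool mA.
have PE : P [set w | c <= `|f w|] = (E (fun w => (c <= `|f w|)%R%:R))%:E.
  rewrite fineK; last first.
    by apply: integrable_fin_num => //; exact: bounded_measurable_integrable.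
  rewrite -[X in P X]setIT -integral_indic//; last first.
    by rewrite -[X in measurable X]setTI; exact: mA.
  by apply: eq_integral => w _; rewrite indicE mem_setE.
rewrite PE lee_fin ler_pdivlMr ?exprn_gt0// mulrC -RintegralZl_bounded//.
have bf2 : bmf (fun w => f w ^+ 2).
  by under eq_fun do rewrite expr2; exact: bounded_measurableM.
apply: le_Rintegral_bounded => //.
  by apply: bounded_measurableM => //; exact: bounded_measurable_cst.
move=> w; case: (leP c) => h; rewrite /= ?mulr0 ?sqr_ge0// mulr1.
rewrite -(real_normK (num_real (f w))).
by rewrite ler_sqr ?nnegrE// ltW.
Qed.

End bounded_measurable.

Section martingale_differences.
Context d (T : measurableType d) (R : realType) (P : probability T R).
Local Notation bmf := (@bounded_measurable _ T R).
Local Notation E f := (\int[P]_w f w).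

(* A n is the set of functions that are determined by the first n steps. *)
Variable A : nat -> set (T -> R).
Hypothesis A_measurable : forall n f, A n f -> measurable_fun setT f.
Hypothesis A_cst : forall n c, A n (fun=> c).
Hypothesis A_comp : forall n (psi : R * R -> R) f g, measurable_fun setT psi ->
  A n f -> A n g -> A n (fun w => psi (f w, g w)).
Hypothesis A_S : forall n, A n `<=` A n.+1.

Variable D : nat -> T -> R.
Hypothesis D_adapted : forall n, A n.+1 (D n).
Hypothesis D_bounded : forall n w, `|D n w| <= 1.
(** The integrated form of a vanishing conditional mean. *)
Hypothesis D_orthogonal : forall n f, A n f -> bmf f ->
  E (fun w => f w * D n w) = 0.

Let bD n : bmf (D n).
Proof. by split; [exact: A_measurable (D_adapted n)|exists 1]. Qed.

Section stopped.
Variables (m : nat) (c : R).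

(* The partial sums from m on, frozen when their modulus reaches c. *)
Fixpoint stopped (k : nat) (w : T) : R :=
  if k is k'.+1 then
    stopped k' w + (if `|stopped k' w| < c then D (m + k') w else 0)
  else 0.

Let mlt : measurable_fun setT (fun p : R * R => `|p.1| < c).
Proof.
by apply: measurable_fun_ltr => //; exact: measurableT_comp.
Qed.

Lemma stopped_adapted k : A (m + k) (stopped k).
Proof.
elim: k => [|k ih] /=; first exact: A_cst.
pose psi (p : R * R) := p.1 + (if `|p.1| < c then p.2 else 0).
rewrite addnS; apply: (@A_comp _ psi _ _ _ (A_S ih) (D_adapted _)).
by apply: measurable_funD => //; exact: measurable_fun_ifT.
Qed.

Lemma stopped_bounded k : bmf (stopped k).
Proof.
split; first exact: A_measurable (stopped_adapted k).
exists k%:R => w; elim: k => [|k ih] /=; first by rewrite normr0.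
apply: le_trans (ler_normD _ _) _; rewrite -natr1 lerD//.
by case: ifP => // _; rewrite normr0.
Qed.

(** The cross term in the square of [stopped k.+1] is [f * D], where [f] is bounded and determined
    by the past, so its integral is 0. Freezing only drops squares of increments. *)
Lemma stopped_second_moment k :
  E (fun w => stopped k w ^+ 2) <=
  \sum_(m <= i < m + k) E (fun w => D i w ^+ 2).
Proof.
elim: k => [|k ih].
  by rewrite addn0 big_geq//= expr0n /= Rintegral_cst// mul0r.
rewrite addnS big_nat_recr ?leq_addr//=.
pose f w := if `|stopped k w| < c then 2 * stopped k w else 0.
pose psi (p : R * R) : R := if `|p.1| < c then 2 * p.1 else 0.
have Af : A (m + k) f.
  apply: (@A_comp _ psi _ _ _ (stopped_adapted k) (stopped_adapted k)).
  by apply: measurable_fun_ifT => //; exact: measurable_funM.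
have [mS [M SM]] := stopped_bounded k.
have bf : bmf f.
  split; first exact: A_measurable Af.
  exists (2 * M) => w; rewrite /f; case: ifP => _.
    by rewrite normrM normr_nat ler_pM2l.
  by rewrite normr0 mulr_ge0// (le_trans _ (SM w)).
have sq g : bmf g -> bmf (fun w => g w ^+ 2).
  by move=> bg; under eq_fun do rewrite expr2; exact: bounded_measurableM.
have bS := sq _ (stopped_bounded k); have bDk := sq _ (bD (m + k)).
have bfD := bounded_measurableM bf (bD (m + k)).
apply: (@le_trans _ _ (E (fun w => (stopped k w ^+ 2 + f w * D (m + k) w) +
    D (m + k) w ^+ 2))).
  apply: le_Rintegral_bounded.
  - exact: sq (stopped_bounded k.+1).
  - by apply: bounded_measurableD => //; exact: bounded_measurableD.
  - move=> w; rewrite /f; case: ifP => _; last first.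
      by rewrite addr0 mul0r addr0 lerDl sqr_ge0.
    by rewrite le_eqVlt; apply/orP; left; apply/eqP; ring.
rewrite !RintegralD_bounded//; last exact: bounded_measurableD.
by rewrite D_orthogonal// addr0 lerD2r.
Qed.

Lemma stopped_frozen k j w :
  c <= `|stopped k w| -> stopped (k + j) w = stopped k w.
Proof.
move=> h; elim: j => [|j ih]; first by rewrite addn0.
by rewrite addnS /= ih ltNge h /= addr0.
Qed.

Lemma stopped_running k w : (forall j, `|stopped j w| < c) ->
  stopped k w = \sum_(m <= i < m + k) D i w.
Proof.
move=> h; elim: k => [|k ih]; first by rewrite addn0 big_geq.
by rewrite /= h ih addnS big_nat_recr ?leq_addr.
Qed.

End stopped.

Variable C : R.
Hypothesis D_square : forall n, \sum_(0 <= i < n) E (fun w => D i w ^+ 2) <= C.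

Let v i := E (fun w => D i w ^+ 2).

Let v_ge0 i : 0 <= v i.
Proof. by apply: Rintegral_ge0 => w _; exact: sqr_ge0. Qed.

Let cvg_v : cvgn (series v).
Proof.
apply: nondecreasing_is_cvgn.
  by apply/nondecreasing_seqP => n; rewrite /series /= big_nat_recr//= lerDl.
by exists C => _ [n _ <-]; exact: D_square.
Qed.

Let exit m c := \bigcup_k [set w | c <= `|stopped m c k w|].

Let measurable_exit_at m c k : measurable [set w | c <= `|stopped m c k w|].
Proof.
rewrite -[X in measurable X]setTI; apply: (_ : measurable_fun setT
  (fun w => c <= `|stopped m c k w|)) => //.
apply: measurable_fun_ler => //; apply: measurableT_comp => //.
by have [] := stopped_bounded m c k.
Qed.

(** Kolmogorov's maximal inequality. A frozen sum stays at its level, so the events increase with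
    [k], and the Chebyshev bound at each [k] passes to their union. *)
Lemma probability_exit m (c : R) : 0 < c ->
  (P (exit m c) <= ((limn (series v) - series v m) / c ^+ 2)%R%:E)%E.
Proof.
move=> c0.
have cP : P [set w | c <= `|stopped m c k w|] @[k --> \oo] --> P (exit m c).
  apply: nondecreasing_cvg_mu => //.
    by apply: bigcupT_measurable => k; exact: measurable_exit_at.
  move=> k l kl; apply/subsetPset => w /= h.
  by rewrite -(subnKC kl) stopped_frozen.
rewrite -(cvg_lim _ cP)//; apply: lime_le.
  by apply/cvg_ex; eexists; exact: cP.
apply: nearW => k.
apply: (le_trans (probability_le_square _ (stopped_bounded m c k) c0)).
rewrite lee_fin ler_pM2r ?invr_gt0 ?exprn_gt0//.
apply: (le_trans (stopped_second_moment m c k)).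
rewrite lerBrDr; apply: (le_trans _ (nondecreasing_cvgn_le _ cvg_v (m + k))).
  by rewrite addrC /series /= -big_cat_nat ?leq_addr.
by apply/nondecreasing_seqP => n; rewrite /series /= big_nat_recr//= lerDl.
Qed.

(** The exceptional paths exit from every start [m]; the probability of this is below every tail of
    [series v] divided by [c ^+ 2]. *)
Lemma ae_not_exit c : 0 < c ->
  {ae P, forall w, exists m, forall k, `|stopped m c k w| < c}.
Proof.
move=> c0; exists (\bigcap_m exit m c); split.
- apply: bigcapT_measurable => m.
  by apply: bigcupT_measurable => k; exact: measurable_exit_at.
- apply/eqP; rewrite eq_le measure_ge0 andbT; apply/lee_addgt0Pr => e e0.
  rewrite add0e.
  have ec : 0 < e * c ^+ 2 by rewrite mulr_gt0// exprn_gt0.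
  have /cvgrPdist_le/(_ _ ec)[m _ /(_ m (leqnn m)) /= hm] := cvg_v.
  apply: (@le_trans _ _ (P (exit m c))).
    apply: le_measure; rewrite ?inE.
    + apply: bigcapT_measurable => n.
      by apply: bigcupT_measurable => k; exact: measurable_exit_at.
    + by apply: bigcupT_measurable => k; exact: measurable_exit_at.
    + exact: bigcap_inf.
  apply: (le_trans (probability_exit m c0)).
  rewrite lee_fin ler_pdivrMr ?exprn_gt0//.
  exact: le_trans (ler_norm _) hm.
- move=> w /= nw m _; apply: contrapT => nx; apply: nw; exists m => k.
  by rewrite ltNge; apply/negP => h; apply: nx; exists k.
Qed.

(** For each level [1 / j.+1], almost every path has a start from which no freezing occurs; two
    partial sums from that start differ by less than twice the level, which is the Cauchy
    criterion. *)
Lemma martingale_differences_cvg :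
  {ae P, forall w, cvgn (series (fun n => D n w))}.
Proof.
have := ae_foralln (fun j : nat => ae_not_exit (_ : 0 < j.+1%:R^-1)).
have j0 (j : nat) : 0 < j.+1%:R^-1 :> R by rewrite invr_gt0.
move=> /(_ j0); apply: filterS => w hw.
apply/cauchy_cvgP/cauchy_seriesP => e e0.
have [j je] : exists j : nat, 2 * j.+1%:R^-1 < e.
  have /cvgrPdist_lt/(_ (e / 2)) := @cvg_harmonic R.
  rewrite divr_gt0// => /(_ isT)[j _ /(_ j (leqnn j))] /=.
  rewrite sub0r normrN gtr0_norm// => h; exists j.
  by rewrite mulrC -ltr_pdivlMr.
have [m hm] := hw j.
have hs k : `|\sum_(m <= i < m + k) D i w| < j.+1%:R^-1.
  by rewrite -(stopped_running k hm); exact: hm.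
near=> p => /=.
have mp1 : (m <= p.1)%N by near: p; exact: cvg_fst (nbhs_infty_ge m).
have mp2 : (m <= p.2)%N by near: p; exact: cvg_snd (nbhs_infty_ge m).
have [p12|p21] := leqP p.1 p.2; last by rewrite big_geq ?normr0// ltnW.
rewrite (_ : \sum_(_ <= _ < _) _ = \sum_(m <= i < m + (p.2 - m)) D i w -
   \sum_(m <= i < m + (p.1 - m)) D i w); last first.
  rewrite !subnKC// [X in X - _](big_cat_nat (n := p.1))//=.
  by rewrite [X in X - _]addrC addrK.
apply: le_lt_trans (ler_normB _ _) _; apply: lt_trans je.
by rewrite mulrC mulr_natr mulr2n ltrD.
Unshelve. all: by end_near. Qed.

End martingale_differences.

(** * Independence and exchangeability *)

Section histories.
Context d (T : measurableType d) (R : realType) (P : probability T R).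
Local Open Scope ereal_scope.

Lemma past_tupleP (x : nat -> R) n : size (past x n) == n.
Proof. by rewrite size_past. Qed.

Definition hist (X : nat -> T -> R) n (w : T) : n.-tuple R :=
  Tuple (past_tupleP (fun i => X i w) n).

Lemma histS (X : nat -> T -> R) n w :
  hist X n.+1 w = [tuple of X n w :: hist X n w].
Proof. exact/val_inj. Qed.

Lemma nth_past (x : nat -> R) n j :
  (j < n)%N -> nth 0%R (past x n) j = x (n.-1 - j)%N.
Proof.
elim: n j => // n ih [|j] jn /=; first by rewrite subn0.
by rewrite ih//; congr x; lia.
Qed.

Lemma tnth_hist (X : nat -> T -> R) n w (j : 'I_n) :
  tnth (hist X n w) j = X (n.-1 - j)%N w.
Proof. by rewrite (tnth_nth 0%R) /= nth_past. Qed.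

Definition iid (mu : probability R R)
    (X : nat -> {RV P >-> R}) : Prop :=
  mutually_independent xpredT X /\
  forall n B, measurable B -> P (X n @^-1` B) = mu B.

Variable mu : probability R R.

Section one_sequence.
Variable X : nat -> {RV P >-> R}.

Lemma measurable_hist n : measurable_fun setT (hist X n).
Proof.
apply/measurable_fun_tnthP => j.
rewrite (_ : _ \o _ = X (n.-1 - j)%N); first exact: measurable_funP.
by apply/funext => w /=; rewrite tnth_hist.
Qed.

HB.instance Definition _ n :=
  isMeasurableFun.Build _ _ _ _ (hist X n) (@measurable_hist n).

Hypothesis iidX : iid mu X.

(** Unlike cylinders over a single coordinate, boxes are stable under intersection, as the
    uniqueness theorem for measures demands. *)
Lemma measurable_tuple_boxes n : @measurable _ (n.-tuple R) =
  <<s [set A | exists2 C : nat -> set R, (forall i, measurable (C i)) &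
    A = [set v | forall j : 'I_n, C j (tnth v j)]] >>.
Proof.
apply/seteqP; split.
  apply: smallest_sub; first exact: smallest_sigma_algebra.
  move=> A; rewrite -bigcup_seq => -[j _ [B mB <-]].
  apply: sub_sigma_algebra.
  exists (fun i : nat => if i == j :> nat then B else setT).
    by move=> i; case: ifP.
  apply/seteqP; split => v /=.
    by move=> [_ Bv] i; case: ifPn => // /eqP/val_inj ->.
  by move=> /(_ j); rewrite eqxx.
apply: smallest_sub; first exact: sigma_algebra_measurable.
move=> _ [C mC ->].
rewrite (_ : [set _ | _] =
    \bigcap_(j in [set: 'I_n]) ((@tnth n R ^~ j) @^-1` C j)); last first.
  by apply/seteqP; split => v /= h j; [move=> _; exact: h|exact: (h j I)].
apply: fin_bigcap_measurable => // j _.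
by rewrite -[X in measurable X]setTI; exact: measurable_tnth.
Qed.

(** Both sides are finite measures in [A]; mutual independence makes them agree on boxes, hence
    everywhere. *)
Lemma hist_independent n (A : set (n.-tuple R)) (B : set R) :
  measurable A -> measurable B ->
  P (hist X n @^-1` A `&` X n @^-1` B) = P (hist X n @^-1` A) * mu B.
Proof.
move=> mA mB; have [indep ident] := iidX.
have mXB : measurable (X n @^-1` B) by exact: measurable_funPTI.
pose m1 : {measure set (n.-tuple R) -> \bar R} :=
  measure_function_pushforward__canonical__measure_function_Measure
    (mrestr P mXB) (@measurable_hist n).
pose nu : {nonneg R} := NngNum (fine_ge0 (measure_ge0 mu B)).
pose m2 : {measure set (n.-tuple R) -> \bar R} :=
  mscale nu (distribution P (hist X n)).
have nuE : nu%:num%:E = mu B by rewrite /= fineK// fin_num_measure.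
suff : m1 A = m2 A.
  by rewrite /m1 /m2 /= /mscale /= nuE muleC.
apply: (measure_unique _ (fun=> setT) (measurable_tuple_boxes n)) => //.
- move=> _ _ [C mC ->] [C' mC' ->].
  exists (fun i => C i `&` C' i); first by move=> i; exact: measurableI.
  apply/seteqP; split => v /=; first by move=> [h h'] j; split.
  by move=> h; split => j; have [] := h j.
- move=> _; exists (fun=> setT) => //.
  by apply/seteqP; split.
- by rewrite bigcup_const.
- move=> _ [C mC ->].
  set box := [set v | _].
  transitivity (P (hist X n @^-1` box `&` X n @^-1` B)) => //.
  transitivity (mu B * P (hist X n @^-1` box)); last by rewrite -nuE.
  (* The history lists the latest value first, so coordinate [j] of the box constrains
     [X (n.-1 - j)]. *)
  pose C' i := if i == n then B else C (n.-1 - i)%N.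
  have mC' i : measurable (C' i) by rewrite /C'; case: ifP.
  have subT (s : seq nat) : {subset s <= xpredT} by [].
  have E1 := indep (iota 0 n) C' (iota_uniq _ _) (subT _) mC'.
  have E2 := indep (iota 0 n.+1) C' (iota_uniq _ _) (subT _) mC'.
  have bE : hist X n @^-1` box =
      \bigcap_(i in [set` iota 0 n]) (X i @^-1` C' i).
    apply/seteqP; split => w /= h.
      move=> i /=; rewrite mem_iota add0n /= => lin.
      rewrite /C' ltn_eqF//.
      have jn : (n.-1 - i < n)%N by lia.
      have := h (Ordinal jn); rewrite tnth_hist /=.
      by rewrite (_ : (n.-1 - (n.-1 - i))%N = i)//; lia.
    move=> j; rewrite tnth_hist; have jn := ltn_ord j.
    have := h (n.-1 - j)%N; rewrite /= mem_iota add0n /C' ltn_eqF; last by lia.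
    rewrite (_ : (n.-1 - (n.-1 - j))%N = j); last by lia.
    by apply; lia.
  have bE' : hist X n @^-1` box `&` X n @^-1` B =
      \bigcap_(i in [set` iota 0 n.+1]) (X i @^-1` C' i).
    have iotaE m i : [set` iota 0 m] i = (i < m)%N.
      by rewrite -[LHS]/(is_true (i \in iota 0 m)) mem_iota.
    rewrite bE; apply/seteqP; split => w.
      move=> [h hn] i; rewrite iotaE ltnS leq_eqVlt.
      move=> /orP[/eqP ->|lin]; first by rewrite /C' /preimage /= eqxx.
      by apply: h; rewrite iotaE.
    move=> h; split; last first.
      have nn : [set` iota 0 n.+1] n by rewrite iotaE.
      by have := h n nn; rewrite /C' /preimage /= eqxx.
    move=> i; rewrite iotaE => lin; apply: h.
    by rewrite iotaE ltnW.
  rewrite bE' bE E1 E2 -addn1 iotaD big_cat /= big_seq1 add0n /C' eqxx.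
  by rewrite ident// muleC.
- move=> _; have -> : m1 setT = P (X n @^-1` B) by rewrite -[X n @^-1` B]setTI.
  by rewrite (le_lt_trans (probability_le1 P mXB))// ltry.
Qed.

Lemma hist_fubini n (F : n.-tuple R * R -> \bar R) :
  measurable_fun setT F -> (forall z, 0 <= F z) ->
  \int[P]_w F (hist X n w, X n w) = \int[P]_w \int[mu]_y F (hist X n w, y).
Proof.
move=> mF F0.
have mp : measurable_fun setT (fun w => (hist X n w, X n w)).
  by apply: measurable_fun_pair; [exact: measurable_hist|exact: measurable_funP].
pose p : {mfun T >-> (n.-tuple R * R)%type} :=
  HB.pack (fun w => (hist X n w, X n w)) (isMeasurableFun.Build _ _ _ _ _ mp).
rewrite -(@ge0_integral_distribution _ _ _ _ _ P p F)//.
rewrite (@eq_measure_integral _ _ _ _ (distribution P (hist X n) \x mu)); last first.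
  move=> A mA _; apply/esym.
  apply: (@product_measure_unique _ _ _ _ _ (distribution P (hist X n)) mu
    (distribution P p)) => //.
  by move=> A1 B1 mA1 mB1; rewrite -hist_independent.
rewrite fubini_tonelli1//.
rewrite (@ge0_integral_distribution _ _ _ _ _ P (hist X n))//.
- exact: measurable_fun_fubini_tonelli_F.
- by move=> y; exact: integral_ge0.
Qed.

End one_sequence.

Lemma measurable_cons_tuple n :
  measurable_fun setT (fun z : n.-tuple R * R => [tuple of z.2 :: z.1]).
Proof. exact: measurable_cons. Qed.

(** Integrating out the latest value leaves a function of a shorter history, the same one for both
    sequences. *)
Lemma hist_eq_law (X X' : nat -> {RV P >-> R}) n (F : n.-tuple R -> \bar R) :
  iid mu X -> iid mu X' -> measurable_fun setT F -> (forall v, 0 <= F v) ->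
  \int[P]_w F (hist X n w) = \int[P]_w F (hist X' n w).
Proof.
move=> iX iX'; elim: n F => [|n ih] F mF F0.
  by apply: eq_integral => w _; congr F; exact/val_inj.
pose F1 (z : n.-tuple R * R) := F [tuple of z.2 :: z.1].
have mF1 : measurable_fun setT F1.
  by apply: measurableT_comp => //; exact: measurable_cons_tuple.
have F10 z : 0 <= F1 z by exact: F0.
have step (Z : nat -> {RV P >-> R}) : iid mu Z ->
    \int[P]_w F (hist Z n.+1 w) = \int[P]_w fubini_F mu F1 (hist Z n w).
  move=> iZ; rewrite -(hist_fubini iZ mF1 F10).
  by apply: eq_integral => w _; rewrite histS.
rewrite (step X iX) (step X' iX'); apply: ih.
  exact: measurable_fun_fubini_tonelli_F.
by move=> v; exact: integral_ge0.
Qed.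

Definition transpose (i j k : nat) : nat :=
  if k == i then j else if k == j then i else k.

Lemma transposeK i j : involutive (transpose i j).
Proof.
move=> k; rewrite /transpose.
case: (eqVneq k i) => [->|ki].
  by case: (eqVneq j i) => [->//|_]; rewrite eqxx.
case: (eqVneq k j) => [->|kj]; first by rewrite eqxx.
by rewrite (negbTE ki) (negbTE kj).
Qed.

Lemma iid_reindex (X : nat -> {RV P >-> R}) (s : nat -> nat) :
  involutive s -> iid mu X -> iid mu (fun n => X (s n)).
Proof.
move=> sK [indep ident]; split => [J B uJ _ mB|n B mB]; last exact: ident.
have := indep (map s J) (fun i => B (s i)).
rewrite map_inj_uniq ?uJ; last exact: inv_inj.
move=> /(_ isT (fun _ _ => isT) (fun i => mB _)).
rewrite big_map; under eq_bigr do rewrite sK; move=> <-; congr (P _).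
apply/seteqP; split => w /= h i /= iJ.
  have [j jJ e] := mapP iJ; move: iJ; rewrite e sK => _; exact: h.
by have := h (s i); rewrite sK; apply; rewrite /= map_f.
Qed.

Lemma perm_past_transpose (x : nat -> R) i n : (i <= n)%N ->
  perm_eq (past (fun k => x (transpose i n k)) n.+1) (past x n.+1).
Proof.
move=> lin.
have pE (y : nat -> R) m : past y m = rev (map y (iota 0 m)).
  elim: m => // m ih; rewrite -addn1 iotaD map_cat rev_cat /= addn1 /=.
  by rewrite ih.
rewrite !pE perm_rev perm_sym perm_rev perm_sym.
rewrite (map_comp x) perm_map// uniq_perm ?iota_uniq//.
  by rewrite map_inj_uniq ?iota_uniq//; exact/inv_inj/transposeK.
move=> k; rewrite -{1}(transposeK i n k) mem_map; last exact/inv_inj/transposeK.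
rewrite !mem_iota !add0n /transpose !leq0n /=.
case: (eqVneq k i) => [->|ki]; first by rewrite !ltnS lin leqnn.
by case: (eqVneq k n) => [->|kn]; rewrite // !ltnS lin leqnn.
Qed.

End histories.

(** * Measurability of the hiring decisions *)

Section measurability.
Context d (S : measurableType d) (R : realType).

(** Preimages split over the countably many values of [f], on each of which the argument [f s] is a
    constant. *)
Lemma measurable_fun_nat_case d' (U : measurableType d') (f : S -> nat)
    (g : nat -> S -> U) : measurable_fun setT f ->
  (forall k, measurable_fun setT (g k)) ->
  measurable_fun setT (fun s => g (f s) s).
Proof.
move=> mf mg _ A mA; rewrite setTI.
rewrite (_ : _ @^-1` A = \bigcup_k (f @^-1` [set k] `&` g k @^-1` A)).
  apply: bigcupT_measurable => k; apply: measurableI.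
    by rewrite -[X in measurable X]setTI; exact: mf.
  by rewrite -[X in measurable X]setTI; exact: mg.
apply/seteqP; split => s /=; first by move=> h; exists (f s).
by move=> [k _ [/= ->]].
Qed.

Lemma measurable_addn (f g : S -> nat) : measurable_fun setT f ->
  measurable_fun setT g -> measurable_fun setT (fun s => (f s + g s)%N).
Proof.
move=> mf mg.
apply: (@measurable_fun_nat_case _ _ f (fun k s => (k + g s)%N)) => // k.
exact: (@measurableT_comp _ _ _ _ _ _ (addn k)).
Qed.

Lemma measurable_bool_nat (b : S -> bool) : measurable_fun setT b ->
  measurable_fun setT (fun s => b s : nat).
Proof.
move=> mb; rewrite (_ : (fun s => _) = fun s => if b s then 1%N else 0%N).
  exact: measurable_fun_ifT.
by apply/funext => s; case: (b s).
Qed.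

Lemma measurable_ltn (f g : S -> nat) : measurable_fun setT f ->
  measurable_fun setT g -> measurable_fun setT (fun s => (f s < g s)%N).
Proof.
move=> mf mg.
apply: (@measurable_fun_nat_case _ _ f (fun k s => (k < g s)%N)) => // k.
exact: (@measurableT_comp _ _ _ _ _ _ (ltn k)).
Qed.

Lemma measurable_bool_EFin (b : S -> bool) :
  measurable_fun setT b -> measurable_fun setT (fun s => (b s)%:R%:E : \bar R).
Proof.
move=> mb; apply/measurable_EFinP.
by have [] := bounded_measurable_bool R mb.
Qed.

End measurability.

Section measurable_hires.
Context (R : realType) (r : nat -> nat).

Lemma measurable_thead n : measurable_fun setT (fun v : n.+1.-tuple R => thead v).
Proof. exact: measurable_tnth. Qed.

Lemma measurable_count d (S : measurableType d) n (v : S -> n.-tuple R)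
    (y : S -> R) :
  measurable_fun setT v -> measurable_fun setT y ->
  measurable_fun setT (fun s => count (fun z => (y s <= z)%R) (v s)).
Proof.
elim: n v => [|n ih] v mv my.
  rewrite (_ : (fun s => _) = fun=> 0%N); first exact: measurable_cst.
  by apply/funext => s; rewrite tuple0.
rewrite (_ : (fun s => _) = fun s => ((y s <= thead (v s))%R +
    count (fun z => (y s <= z)%R) [tuple of behead (v s)])%N).
  apply: measurable_addn.
    apply: measurable_bool_nat; apply: measurable_fun_ler => //.
    by apply: measurableT_comp mv; exact: measurable_thead.
  apply: ih => //; apply: (@measurableT_comp _ _ _ _ _ _
    (fun v : n.+1.-tuple R => [tuple of behead v])) => //.
  exact: measurable_behead.
by apply/funext => s; rewrite {1}(tuple_eta (v s)).
Qed.

Lemma measurable_hires_of d (S : measurableType d) n (v : S -> n.-tuple R)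
    (y : S -> R) : measurable_fun setT (fun v : n.-tuple R => hired r v) ->
  measurable_fun setT v -> measurable_fun setT y ->
  measurable_fun setT (fun s => hires r (v s) (y s)).
Proof.
move=> mh mv my; apply: measurable_ltn; first exact: measurable_count.
apply: (@measurableT_comp _ _ _ _ _ _ r) => //.
exact: (@measurableT_comp _ _ _ _ _ _ (fun v : n.-tuple R => hired r v)).
Qed.

Lemma measurable_hired n : measurable_fun setT (fun v : n.-tuple R => hired r v).
Proof.
elim: n => [|n ih].
  rewrite (_ : (fun s => _) = fun=> 0%N); first exact: measurable_cst.
  by apply/funext => s; rewrite tuple0.
rewrite (_ : (fun v => _) = fun v : n.+1.-tuple R =>
  (hires r [tuple of behead v] (thead v) + hired r [tuple of behead v])%N).
  apply: measurable_addn.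
    apply: measurable_bool_nat; apply: measurable_hires_of => //.
      exact: measurable_behead.
    exact: measurable_thead.
  apply: (@measurableT_comp _ _ _ _ _ _ (fun v : n.-tuple R => hired r v)) => //.
  exact: measurable_behead.
by apply/funext => v; rewrite {1}(tuple_eta v).
Qed.

Lemma measurable_hires d (S : measurableType d) n (v : S -> n.-tuple R)
    (y : S -> R) : measurable_fun setT v -> measurable_fun setT y ->
  measurable_fun setT (fun s => hires r (v s) (y s)).
Proof. by apply: measurable_hires_of; exact: measurable_hired. Qed.

(** The record of decisions, latest first; it generates the smaller of the two filtrations. *)
Fixpoint pattern (s : seq R) : seq bool :=
  if s is y :: s' then hires r s' y :: pattern s' else [::].

Lemma size_pattern s : size (pattern s) = size s.
Proof. by elim: s => //= y s ->. Qed.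

Lemma hired_pattern s : hired r s = count id (pattern s).
Proof. by elim: s => //= y s ih; rewrite -ih. Qed.

Lemma measurable_pattern n (a : seq bool) :
  measurable_fun setT (fun v : n.-tuple R => pattern v == a).
Proof.
elim: n a => [|n ih] a.
  rewrite (_ : (fun s => _) = fun=> [::] == a); first exact: measurable_cst.
  apply/funext => s; by rewrite tuple0.
case: a => [|b a].
  rewrite (_ : (fun s => _) = fun=> false); first exact: measurable_cst.
  apply/funext => v; apply/negbTE/eqP => /(congr1 size).
  by rewrite size_pattern size_tuple.
rewrite (_ : (fun v => _) = fun v : n.+1.-tuple R =>
  if hires r [tuple of behead v] (thead v) == b
  then pattern [tuple of behead v] == a else false).
  apply: measurable_fun_ifT => //.
    apply: (@measurableT_comp _ _ _ _ _ _ (fun c => c == b)) => //.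
    by apply: measurable_hires; [exact: measurable_behead|exact: measurable_thead].
  apply: (@measurableT_comp _ _ _ _ _ _
    (fun v : n.-tuple R => pattern v == a)) => //.
  exact: measurable_behead.
apply/funext => v; rewrite {1}(tuple_eta v) /= eqseq_cons.
by case: (_ == b).
Qed.

End measurable_hires.

(** * Uniformity of the rank of the newest value *)

Section exchangeability.
Context d (T : measurableType d) (R : realType) (P : probability T R).
Local Open Scope ereal_scope.
Variables (mu : probability R R) (X : nat -> {RV P >-> R}).
Hypothesis iidX : iid mu X.
Hypothesis mu_atomless : forall y, mu [set y] = 0.

(** After sorting in decreasing order the rank of a value is its position; the [.-1] discounts the
    value itself. *)
Lemma sum_ranks (s : seq R) (g : nat -> nat) : uniq s ->
  (\sum_(y <- s) g (count (fun z => (y <= z)%R) s).-1 =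
   \sum_(0 <= j < size s) g j)%N.
Proof.
move=> us; pose ge := (fun a b : R => (b <= a)%R).
have ps := permEl (perm_sort ge s).
rewrite -(perm_big _ ps) /=.
under eq_bigr => y _ do rewrite -(seq.permP ps).
rewrite -(size_sort ge s).
have ss : sorted ge (sort ge s) by apply: sort_sorted => a b; exact: ge_total.
move: us; rewrite -(sort_uniq ge).
elim: (sort ge s) ss g => [|a t ih] st g; first by rewrite big_nil big_geq.
move=> /= /andP[nat ut]; rewrite big_cons big_nat_recl//=.
have tr : transitive ge by move=> b c e bc ce; exact: le_trans ce bc.
have /allP ta := order_path_min tr st.
have {}ta z : z \in t -> (z < a)%R.
  move=> zt; rewrite lt_neqAle [(z <= a)%R](ta z zt) andbT.
  by apply: contraNneq nat => <-.
rewrite (_ : count _ t = 0%N); last first.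
  apply/eqP; rewrite -leqn0 leqNgt -has_count; apply/hasPn => z zt.
  by rewrite -ltNge ta.
rewrite lexx addn0; congr (_ + _)%N.
rewrite -(ih (path_sorted st) (fun j => g j.+1) ut).
apply: eq_big_seq => y yt; rewrite (ltW (ta y yt)) add1n /=.
suff : (0 < count (fun z => (y <= z)%R) t)%N by case: count.
by rewrite -has_count; apply/hasP; exists y.
Qed.

Lemma sum_past (x : nat -> R) n (F : R -> nat) :
  (\sum_(y <- past x n) F y = \sum_(i < n) F (x i))%N.
Proof.
elim: n => [|n ih]; first by rewrite big_nil big_ord0.
by rewrite big_cons ih big_ord_recr /= addnC.
Qed.

Lemma measurable_tnth_fst n (j : 'I_n) :
  measurable_fun setT (fun z : n.-tuple R * R => tnth z.1 j).
Proof.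
apply: (@measurableT_comp _ _ _ _ _ _ (fun v : n.-tuple R => tnth v j)) => //.
exact: measurable_tnth.
Qed.

Lemma mem_past (x : nat -> R) n y : y \in past x n ->
  exists2 i, (i < n)%N & y = x i.
Proof.
elim: n => //= n ih; rewrite inE => /predU1P[->|/ih[i lin ->]]; first by exists n.
by exists i => //; rewrite ltnS ltnW.
Qed.

(** Integrating over the later value first leaves the mass of a single point. *)
Lemma ae_neq i j : (i < j)%N -> {ae P, forall w, X i w != X j w}.
Proof.
move=> ij.
have kj : (j.-1 - i < j)%N by lia.
pose b (z : j.-tuple R * R) := tnth z.1 (Ordinal kj) == z.2.
have mb : measurable_fun setT b.
  by apply: measurable_fun_eqr => //; exact: measurable_tnth_fst.
pose F z : \bar R := (b z)%:R%:E.
have mF : measurable_fun setT F.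
  exact: measurable_bool_EFin.
have F0 z : 0 <= F z by rewrite lee_fin.
have FE w : F (hist X j w, X j w) = (X i w == X j w)%:R%:E.
  by rewrite /F /b /= tnth_hist /= (_ : (j.-1 - (j.-1 - i))%N = i)//; lia.
have mA : measurable [set w | X i w == X j w].
  rewrite -[X in measurable X]setTI.
  apply: (_ : measurable_fun setT (fun w => X i w == X j w)) => //.
  exact: measurable_fun_eqr.
exists [set w | X i w == X j w]; split => //; last first.
  by move=> w /= /negP; rewrite negbK.
rewrite -[X in P X]setIT -integral_indic//.
transitivity (\int[P]_w F (hist X j w, X j w)).
  by apply: eq_integral => w _; rewrite FE indicE mem_setE.
rewrite (hist_fubini iidX mF F0); apply: integral0_eq => w _.
rewrite -[RHS](mu_atomless (tnth (hist X j w) (Ordinal kj))).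
rewrite -[X in mu X]setIT -integral_indic//.
apply: eq_integral => y _; rewrite /F /b /= indicE.
congr ((nat_of_bool _)%:R%:E).
by apply/eqP/idP => [->|/set_mem ->//]; exact: mem_set.
Qed.

Lemma ae_uniq_past : {ae P, forall w, forall n, uniq (past (fun i => X i w) n)}.
Proof.
have h i j : {ae P, forall w, (i < j)%N -> X i w != X j w}.
  case: (ltnP i j) => ij; last by apply: aeW.
  by apply: filterS (ae_neq ij) => w + _.
have := ae_foralln (fun j => ae_foralln (fun i => h i j)).
apply: filterS => w hw; elim => //= n ->; rewrite andbT.
by apply/negP => /mem_past[i lin e]; have := hw n i lin; rewrite e eqxx.
Qed.

(* Exchanging candidates i and n preserves the law and the symmetric function h,
   so the integral is the same for the rank of any i <= n among the n.+1 values;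
   and those ranks are 0, ..., n. *)
Lemma rank_uniform n (b : pred nat) (h : n.+1.-tuple R -> \bar R) :
  measurable_fun setT h -> (forall v, 0 <= h v) ->
  (forall u v : n.+1.-tuple R, perm_eq u v -> h u = h v) ->
  \int[P]_w ((b (count (fun z => (X n w <= z)%R) (hist X n w)))%:R%:E *
    h (hist X n.+1 w)) =
  ((\sum_(0 <= j < n.+1) b j)%N%:R / n.+1%:R)%:E * \int[P]_w h (hist X n.+1 w).
Proof.
move=> mh h0 hperm.
(* The rank is taken among all [n.+1] values, the candidate's own included, hence the [.-1]; for
   [i = n] it is the count over the earlier values. *)
pose bx (x : nat -> R) i := b (count (fun z => (x i <= z)%R) (past x n.+1)).-1.
pose f i w : \bar R := (bx (fun k => X k w) i)%:R%:E * h (hist X n.+1 w).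
pose g (v : n.+1.-tuple R) : \bar R :=
  (b (count (fun z => (thead v <= z)%R) v).-1)%:R%:E * h v.
have mrank d' (S : measurableType d') (y : S -> R) (v : S -> n.+1.-tuple R) :
    measurable_fun setT y -> measurable_fun setT v ->
    measurable_fun setT (fun s =>
      (b (count (fun z => (y s <= z)%R) (v s)).-1)%:R%:E : \bar R).
  move=> my mv; apply: measurable_bool_EFin.
  apply: (@measurableT_comp _ _ _ _ _ _ (fun k => b k.-1)) => //.
  exact: measurable_count.
have mg : measurable_fun setT g.
  apply: emeasurable_funM => //.
  apply: (mrank _ _ (fun v : n.+1.-tuple R => thead v) id) => //.
  exact: measurable_thead.
have mhist : measurable_fun setT (fun w => h (hist X n.+1 w)).
  by apply: measurableT_comp => //; exact: measurable_hist.
have mf i : measurable_fun setT (f i).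
  apply: emeasurable_funM => //.
  by apply: (mrank _ _ (X i) (hist X n.+1)) => //; exact: measurable_hist.
have g0 v : 0 <= g v by rewrite mule_ge0// lee_fin.
have f0 i w : 0 <= f i w by rewrite mule_ge0// lee_fin.
have fE i : (i < n.+1)%N -> \int[P]_w f i w = \int[P]_w g (hist X n.+1 w).
  move=> lin.
  have iX := iid_reindex (transposeK i n) iidX.
  rewrite (hist_eq_law iidX iX mg g0); apply: eq_integral => w _.
  have pe := @perm_past_transpose _ (fun k => X k w) i n lin.
  rewrite /g; congr (_ * _); last first.
    by apply: hperm; rewrite perm_sym; exact: pe.
  have -> : thead (hist (fun k => X (transpose i n k)) n.+1 w) = X i w.
    rewrite /thead (tnth_nth 0%R) /= /transpose eqxx.
    by case: eqVneq => // ->.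
  by rewrite /bx -(seq.permP pe).
have sumf w : uniq (past (fun k => X k w) n.+1) ->
    \sum_(i < n.+1) f i w = (\sum_(0 <= j < n.+1) b j)%N%:R%:E * h (hist X n.+1 w).
  move=> u.
  rewrite -ge0_sume_distrl => [|i _]; last by rewrite lee_fin.
  congr (_ * _); rewrite sumEFin -natr_sum; congr (_%:R%:E).
  have := sum_ranks b u; rewrite size_past => <-.
  by rewrite (sum_past _ _ (fun y => b (count _ _).-1)).
have n0 : n.+1%:R != 0%R :> R by rewrite pnatr_eq0.
set I := (X in X = _); set J := \int[P]_w _.
have IE : I = \int[P]_w f n w.
  by apply: eq_integral => w _; rewrite /f /bx /= lexx add1n.
suff e : n.+1%:R%:E * I = (\sum_(0 <= j < n.+1) b j)%N%:R%:E * J.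
  by rewrite mulrC EFinM -muleA -e muleA -EFinM mulVf// mul1e.
transitivity (\sum_(i < n.+1) \int[P]_w f i w).
  rewrite (eq_bigr (fun=> I)) => [|i _]; last by rewrite IE !fE.
  by rewrite sumr_const card_ord mule_natl.
rewrite -(ge0_integral_sum _ _ (fun i : 'I_n.+1 => mf i))// -ge0_integralZl//.
apply: ge0_ae_eq_integral => //.
- by apply: emeasurable_sum => i; exact: mf.
- exact: emeasurable_funM.
- by move=> w _; exact: sume_ge0.
- by move=> w _; rewrite mule_ge0// lee_fin.
- by apply: filterS ae_uniq_past => w u _; exact: sumf (u n.+1).
Qed.

End exchangeability.

(** * Independence of the decisions from the unordered values *)

Section pattern_independence.
Context d (T : measurableType d) (R : realType) (P : probability T R).
Local Open Scope ereal_scope.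
Variables (mu : probability R R) (X : nat -> {RV P >-> R}).
Hypothesis iidX : iid mu X.
Hypothesis mu_atomless : forall y, mu [set y] = 0.
Variable r : nat -> nat.

Lemma integral_probability_cst (c : \bar R) : \int[P]_w cst c w = c.
Proof.
transitivity (c * P setT); first exact: integral_cst.
by rewrite probability_setT mule1.
Qed.

Let is_pattern n (a : seq bool) (w : T) : \bar R :=
  (pattern r (hist X n w) == a)%:R%:E.

Let rank n w := count (fun z => (X n w <= z)%R) (hist X n w).

Definition symmetric n (h : n.-tuple R -> \bar R) :=
  forall u v : n.-tuple R, perm_eq u v -> h u = h v.

(** Symmetric functions stand for the unordered collection of values. Allowing all of them, and not
    merely events about the next rank, gives an induction hypothesis strong enough to pass from [n]
    to [n.+1]. *)
Let independent_at n := forall a (h : n.-tuple R -> \bar R),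
  measurable_fun setT h -> (forall v, 0 <= h v) -> symmetric h ->
  \int[P]_w (is_pattern n a w * h (hist X n w)) =
  (\int[P]_w is_pattern n a w) * \int[P]_w h (hist X n w).

Let measurable_is_pattern n a :
  measurable_fun setT (fun v : n.-tuple R => (pattern r v == a)%:R%:E : \bar R).
Proof. by apply: measurable_bool_EFin; exact: measurable_pattern. Qed.

(** The average of [b] of the rank times [h] over the newest value is symmetric in the older ones.
    The hypothesis at [n] therefore splits off the decisions, and the uniform rank gives what
    remains. *)
Let pattern_rank_of n a (b : pred nat) (h : n.+1.-tuple R -> \bar R) :
  independent_at n ->
  measurable_fun setT h -> (forall v, 0 <= h v) -> symmetric h ->
  \int[P]_w (is_pattern n a w * ((b (rank n w))%:R%:E * h (hist X n.+1 w))) =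
  (\int[P]_w is_pattern n a w) *
    (((\sum_(0 <= j < n.+1) b j)%N%:R / n.+1%:R)%:E * \int[P]_w h (hist X n.+1 w)).
Proof.
move=> indep mh h0 hperm.
pose G (z : n.-tuple R * R) : \bar R :=
  (b (count (fun x => (z.2 <= x)%R) z.1))%:R%:E * h [tuple of z.2 :: z.1].
have mG : measurable_fun setT G.
  apply: emeasurable_funM.
    apply: measurable_bool_EFin.
    by apply: (@measurableT_comp _ _ _ _ _ _ b) => //; exact: measurable_count.
  by apply: measurableT_comp => //; exact: measurable_cons_tuple.
have G0 z : 0 <= G z by rewrite mule_ge0// lee_fin.
pose F (z : n.-tuple R * R) : \bar R := (pattern r z.1 == a)%:R%:E * G z.
have mF : measurable_fun setT F.
  apply: emeasurable_funM => //.
  apply: (@measurableT_comp _ _ _ _ _ _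
    (fun v : n.-tuple R => (pattern r v == a)%:R%:E : \bar R)) => //.
  exact: measurable_is_pattern.
have F0 z : 0 <= F z by rewrite mule_ge0// lee_fin.
have GE w : G (hist X n w, X n w) = (b (rank n w))%:R%:E * h (hist X n.+1 w).
  by rewrite /G /= histS.
transitivity (\int[P]_w F (hist X n w, X n w)).
  by apply: eq_integral => w _; rewrite /F GE.
rewrite (hist_fubini iidX mF F0).
have mG2 v : measurable_fun setT (fun y => G (v, y)).
  by apply: measurableT_comp => //; exact: pair1_measurable.
transitivity (\int[P]_w (is_pattern n a w * fubini_F mu G (hist X n w))).
  apply: eq_integral => w _; rewrite /F /= ge0_integralZl_EFin//.
rewrite indep; last 3 first.
- exact: measurable_fun_fubini_tonelli_F.
- by move=> v; exact: integral_ge0.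
- move=> u v uv; apply: eq_integral => y _; rewrite /G /=.
  rewrite (seq.permP uv); congr (_ * _); apply: hperm.
  by rewrite /= perm_cons.
congr (_ * _); rewrite -(hist_fubini iidX mG G0).
rewrite -(rank_uniform iidX mu_atomless b mh h0 hperm).
by apply: eq_integral => w _; rewrite GE.
Qed.

(** On the event that the earlier pattern is [a] the number of hires is fixed, so the next decision
    is a condition on the rank alone. *)
Let is_patternS n b a w : is_pattern n.+1 (b :: a) w =
  is_pattern n a w * ((rank n w < r (count id a))%N == b)%:R%:E.
Proof.
rewrite /is_pattern /= eqseq_cons andbC -EFinM.
case: eqP => [e|_] /=; last by rewrite mul0r.
by rewrite mul1r /hires hired_pattern e.
Qed.

(* Integrating out the last value leaves a symmetric function of the others. *)
Lemma pattern_independent n : independent_at n.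
Proof.
elim: n => [|n ih] a h mh h0 hperm.
  have -> : is_pattern 0 a = cst ((([::] : seq bool) == a)%:R%:E).
    by apply/funext.
  rewrite ge0_integralZl_EFin//; last first.
    by apply: measurableT_comp => //; exact: measurable_hist.
  by rewrite integral_probability_cst.
case: a => [|b a].
  have z w : is_pattern n.+1 [::] w = 0 by [].
  under eq_integral do rewrite z mul0e.
  by under [in RHS]eq_integral do rewrite z; rewrite integral0 mul0e.
under eq_integral do rewrite is_patternS -muleA.
rewrite (pattern_rank_of a (fun j => (j < r (count id a))%N == b) ih mh h0 hperm).
(* The case [h = 1] of the same formula evaluates the probability of the longer pattern. *)
under [in RHS]eq_integral do rewrite is_patternS -[_%:R%:E]mule1.
rewrite (pattern_rank_of a (fun j => (j < r (count id a))%N == b) ih (h := cst 1))//=.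
by rewrite integral_probability_cst mule1 muleA.
Qed.

Hypothesis r_le : forall m, (r m <= m.+1)%N.

(** After [k] hires the newcomer is hired for [r k] of the [n.+1] equally likely ranks; here
    [r k <= k.+1 <= n.+1]. A pattern of the wrong length makes both sides 0. *)
Lemma pattern_hires n (a : seq bool) :
  \int[P]_w (is_pattern n a w * (hires r (hist X n w) (X n w))%:R%:E) =
  ((r (count id a))%:R / n.+1%:R)%:E * \int[P]_w is_pattern n a w.
Proof.
have [sa|na] := eqVneq (size a) n; last first.
  have z w : is_pattern n a w = 0.
    rewrite /is_pattern; case: eqP => // e.
    by move: na; rewrite -e size_pattern size_past eqxx.
  under eq_integral do rewrite z mul0e.
  by under [in RHS]eq_integral do rewrite z; rewrite integral0 mule0.
have kn : (r (count id a) <= n.+1)%N.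
  by rewrite (leq_trans (r_le _))// ltnS -sa count_size.
transitivity (\int[P]_w (is_pattern n a w *
    ((rank n w < r (count id a))%N%:R%:E * cst 1 (hist X n.+1 w)))).
  apply: eq_integral => w _; rewrite mule1 /is_pattern.
  by case: eqP => [e|_]; rewrite ?mul0e// /hires hired_pattern e.
rewrite (pattern_rank_of a (fun j => (j < r (count id a))%N)
  (@pattern_independent n) (h := cst 1))//=.
rewrite integral_probability_cst mule1 muleC; congr ((_%:R / _)%:E * _).
rewrite (big_cat_nat (n := r (count id a)))//=.
rewrite (eq_big_nat _ _ (F2 := fun=> 1%N)) => [|j /andP[_ ->]//].
rewrite sum_nat_const_nat subn0 muln1 big_nat big1 ?addn0// => j /andP[kj _].
by rewrite ltnNge kj.
Qed.

End pattern_independence.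

(** * The two martingales *)

Section compensated_hires.
Context d (T : measurableType d) (R : realType) (P : probability T R).
Local Notation bmf := (@bounded_measurable _ T R).
Local Notation E f := (\int[P]_w f w).
Variables (mu : probability R R) (X : nat -> {RV P >-> R}).
Hypothesis iidX : iid mu X.
Hypothesis mu_atomless : forall y, mu [set y] = 0%E.
Variable r : nat -> nat.
Hypothesis r0 : r 0%N = 1%N.
Hypothesis r_step : forall m : nat, (r m <= r m.+1 <= (r m).+1)%N.
Variable C : R.
Hypothesis rC : forall n, \sum_(0 <= k < n) (r k)%:R ^- 2 <= C.

Local Notation acc n w := ((hires r (hist X n w) (X n w))%:R : R).
Local Notation u n w := ((r (hired r (hist X n w)))%:R^-1 : R).

Lemma acc_bounded_measurable n : bmf (fun w => acc n w).
Proof.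
by apply/bounded_measurable_bool/measurable_hires => //; exact: measurable_hist.
Qed.

Section compensator.
Variable A : nat -> set (T -> R).
Hypothesis A_measurable : forall n f, A n f -> measurable_fun setT f.
Hypothesis A_cst : forall n c, A n (fun=> c).
Hypothesis A_comp : forall n (psi : R * R -> R) f g, measurable_fun setT psi ->
  A n f -> A n g -> A n (fun w => psi (f w, g w)).
Hypothesis A_S : forall n, A n `<=` A n.+1.
Hypothesis A_acc : forall n, A n.+1 (fun w => acc n w).
Hypothesis A_u : forall n, A n (fun w => u n w).
Variable p : nat -> T -> R.
Hypothesis A_p : forall n, A n (p n).
Hypothesis p01 : forall n w, 0 <= p n w <= 1.
(** The integrated form of [p n] being the conditional mean of the decision given [A n]. *)
Hypothesis p_compensates : forall n f, A n f -> bmf f ->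
  E (fun w => f w * acc n w) = E (fun w => f w * p n w).

Let A_mul n f g : A n f -> A n g -> A n (fun w => f w * g w).
Proof.
move=> Af Ag; apply: (@A_comp n (fun z : R * R => z.1 * z.2)) => //.
exact: measurable_funM.
Qed.

Let A_sub n f g : A n f -> A n g -> A n (fun w => f w - g w).
Proof.
move=> Af Ag; apply: (@A_comp n (fun z : R * R => z.1 - z.2)) => //.
exact: measurable_funB.
Qed.

Let u_gt0 n w : 0 < u n w.
Proof. by rewrite invr_gt0 ltr0n rank_gt0. Qed.

Let u_le1 n w : u n w <= 1.
Proof. by rewrite invf_le1 ?ler1n ?ltr0n rank_gt0. Qed.

Let bu n : bmf (fun w => u n w).
Proof.
split; first exact/A_measurable/A_u.
by exists 1 => w; rewrite gtr0_norm.
Qed.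

Let bp n : bmf (p n).
Proof.
split; first exact/A_measurable/A_p.
by exists 1 => w; have /andP[p0 p1] := p01 n w; rewrite ger0_norm.
Qed.

Let D n w := (acc n w - p n w) * u n w.

Let D_adapted n : A n.+1 (D n).
Proof.
apply: A_mul; last exact/A_S/A_u.
by apply: A_sub; [exact: A_acc|exact/A_S/A_p].
Qed.

Let acc01 n w : 0 <= acc n w <= 1.
Proof. by case: hires => /=; rewrite ?lexx ?ler01. Qed.

Let D_bounded n w : `|D n w| <= 1.
Proof.
rewrite normrM -[leRHS]mulr1 ler_pM//; last by rewrite gtr0_norm.
by have := p01 n w; have := acc01 n w; rewrite ler_norml; lra.
Qed.

Let D_orthogonal n f : A n f -> bmf f -> E (fun w => f w * D n w) = 0.
Proof.
move=> Af bf; have bfu := bounded_measurableM bf (bu n).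
rewrite (_ : (fun w => _) =
    fun w => (f w * u n w) * acc n w - (f w * u n w) * p n w).
  rewrite RintegralB_bounded.
  - by rewrite p_compensates ?subrr//; exact: A_mul.
  - by apply: bounded_measurableM => //; exact: acc_bounded_measurable.
  - exact: bounded_measurableM.
by apply/funext => w; rewrite /D; ring.
Qed.

(** Compensation trades [p] for the decision in the integral against [u * u], whence the factor 2.
    The sum is then bounded by [C] on each path, before integrating. *)
Let D_square n : \sum_(0 <= i < n) E (fun w => D i w ^+ 2) <= 2 * C.
Proof.
have bu2 i : bmf (fun w => u i w * u i w) by exact: bounded_measurableM.
have bua i : bmf (fun w => u i w * u i w * acc i w).
  by apply: bounded_measurableM => //; exact: acc_bounded_measurable.
have bup i : bmf (fun w => u i w * u i w * p i w) by exact: bounded_measurableM.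
have D2 i : E (fun w => D i w ^+ 2) <= 2 * E (fun w => u i w * u i w * acc i w).
  (* for a and p in [0, 1], (a - p)^2 <= a + p *)
  apply: (@le_trans _ _
    (E (fun w => u i w * u i w * acc i w + u i w * u i w * p i w))).
    apply: le_Rintegral_bounded; last 1 first.
    - move=> w; have /andP[p0 p1] := p01 i w.
      have u20 : 0 <= u i w * u i w by rewrite mulr_ge0// ltW.
      rewrite /D exprMn [u i w ^+ 2]expr2 mulrC -mulrDr ler_wpM2l//.
      by case: hires => /=; nra.
    - have bD : bmf (D i).
        split; first exact/A_measurable/D_adapted.
        by exists 1 => w; exact: D_bounded.
      by under eq_fun do rewrite expr2; exact: bounded_measurableM.
    - exact: bounded_measurableD.
  rewrite RintegralD_bounded// -p_compensates//; last exact: A_mul.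
  by rewrite mulr_natl mulr2n.
apply: (@le_trans _ _
  (\sum_(0 <= i < n) 2 * E (fun w => u i w * u i w * acc i w))).
  exact: ler_sum.
rewrite -mulr_sumr ler_pM2l//.
have [bs <-] := Rintegral_sum_bounded P (index_iota 0 n) bua.
have -> : C = E (fun=> C).
  rewrite Rintegral_cst//.
  by rewrite (_ : fine (P setT) = 1) ?mulr1// probability_setT.
apply: le_Rintegral_bounded => //; first exact: bounded_measurable_cst.
move=> w; apply: le_trans (rC (hired r (hist X n w))).
rewrite -(sum_hires r (fun i => X i w) (fun k => (r k)%:R ^- 2) n).
rewrite le_eqVlt; apply/orP; left; apply/eqP; apply: eq_bigr => i _.
by rewrite mulrC -invrM ?unitfE ?pnatr_eq0 -?lt0n ?rank_gt0// expr2.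
Qed.

Lemma compensated_cvg : {ae P, forall w,
  cvgn (series (fun n => (acc n w - p n w) * u n w))}.
Proof.
exact: (@martingale_differences_cvg _ _ _ P A A_measurable A_cst A_comp A_S
  D D_adapted D_bounded D_orthogonal (2 * C) D_square).
Qed.

End compensator.

(** * Compensation given the earlier values *)

Section threshold_compensator.

Let A n : set (T -> R) := [set f | exists2 phi : n.-tuple R -> R,
  measurable_fun setT phi & f = fun w => phi (hist X n w)].

(** The conditional probability of a hire given the history [v]. *)
Let q n (v : n.-tuple R) : R := fine (mu [set y | hires r v y]).

Let measurable_accepting n (v : n.-tuple R) : measurable [set y | hires r v y].
Proof.
rewrite -[X in measurable X]setTI.
apply: (_ : measurable_fun setT (fun y => hires r v y)) => //.
exact: measurable_hires.
Qed.

Let qE n (v : n.-tuple R) : (q v)%:E = (\int[mu]_y (hires r v y)%:R%:E)%E.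
Proof.
rewrite fineK ?fin_num_measure// -[X in mu X]setIT -integral_indic//.
by apply: eq_integral => y _; rewrite indicE mem_setE.
Qed.

Let measurable_hires_pair n : measurable_fun setT
  (fun z : n.-tuple R * R => (hires r z.1 z.2)%:R%:E : \bar R).
Proof. by apply: measurable_bool_EFin; exact: measurable_hires. Qed.

Let measurable_q n : measurable_fun setT (@q n).
Proof.
apply/measurable_EFinP; rewrite (_ : EFin \o _ =
  fubini_F mu (fun z : n.-tuple R * R => (hires r z.1 z.2)%:R%:E)).
  by apply: measurable_fun_fubini_tonelli_F => //; exact: measurable_hires_pair.
by apply/funext => v /=; rewrite qE.
Qed.

Let q_compensates_ge0 n (psi : n.-tuple R -> R) :
  measurable_fun setT psi -> (forall v, 0 <= psi v) ->
  E (fun w => psi (hist X n w) * acc n w) =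
  E (fun w => psi (hist X n w) * q (hist X n w)).
Proof.
move=> mpsi psi0; rewrite /Rintegral; congr fine.
pose F (z : n.-tuple R * R) : \bar R := ((psi z.1)%:E * (hires r z.1 z.2)%:R%:E)%E.
have mF : measurable_fun setT F.
  apply: emeasurable_funM => //.
    by apply/measurable_EFinP; exact: measurableT_comp.
  exact: measurable_hires_pair.
have F0 z : (0 <= F z)%E by rewrite mule_ge0// lee_fin.
transitivity (\int[P]_w F (hist X n w, X n w))%E.
  by apply: eq_integral => w _; rewrite /F EFinM.
rewrite (hist_fubini iidX mF F0); apply: eq_integral => w _.
rewrite EFinM qE -ge0_integralZl_EFin//.
by apply: measurable_bool_EFin; exact: measurable_hires.
Qed.

(** The Fubini argument covers nonnegative factors, so [f] is shifted by its bound [M] and the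
    constant is subtracted afterwards. *)
Let q_compensates n f : A n f -> bmf f ->
  E (fun w => f w * acc n w) = E (fun w => f w * q (hist X n w)).
Proof.
move=> [phi mphi fE] bf; have [_ [M fM]] := bf.
(* The bound on [f] controls [phi] only at attained histories; the maximum makes the shifted
   function nonnegative everywhere. *)
pose psi v := Num.max (phi v + M) 0.
have mpsi : measurable_fun setT psi.
  by apply: measurable_maxr => //; exact: measurable_funD.
have fpsi w : f w + M = psi (hist X n w).
  rewrite /psi max_l ?fE//; have := fM w; rewrite fE ler_norml; lra.
have bq : bmf (fun w => q (hist X n w)).
  split.
    apply: (@measurableT_comp _ _ _ _ _ _ (@q n)).
      exact: measurable_q.
    exact: measurable_hist.
  exists 1 => w; rewrite ger0_norm ?fine_ge0//.
  by rewrite -lee_fin fineK ?fin_num_measure// probability_le1.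
have ba := acc_bounded_measurable n.
(* A bound on an absolute value is nonnegative once the sample space has a point, which it has
   because its mass is 1. *)
have M0 : 0 <= M.
  have [[w _]|/set0P] := pselect ([set: T] !=set0).
    exact: le_trans (fM w).
  move=> /negP; rewrite negbK => /eqP T0.
  have := @probability_setT _ _ _ P; rewrite T0 measure0 => /eqP.
  by rewrite eq_sym onee_eq0.
have e1 := q_compensates_ge0 mpsi (fun v => _ : 0 <= psi v).
have e2 := @q_compensates_ge0 n (fun=> M) (measurable_cst _) (fun=> M0).
have bM : bmf (fun=> M) by exact: bounded_measurable_cst.
have bMf g : bmf g -> bmf (fun w => M * g w).
  by move=> bg; exact: bounded_measurableM.
have bfg g : bmf g -> bmf (fun w => f w * g w).
  by move=> bg; exact: bounded_measurableM.
have dec g : bmf g -> E (fun w => f w * g w) =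
    E (fun w => psi (hist X n w) * g w) - E (fun w => M * g w).
  move=> bg; rewrite (_ : (fun w => psi _ * g w) = fun w => f w * g w + M * g w).
    by rewrite RintegralD_bounded ?addrK//; [exact: bfg|exact: bMf].
  by apply/funext => w; rewrite -fpsi mulrDl.
rewrite !dec// e1 ?e2// => v.
by rewrite /psi le_max lexx orbT.
Qed.

Lemma threshold_compensated_cvg : {ae P, forall w,
  cvgn (series (fun n =>
    (acc n w - fine (mu [set y | hires r (hist X n w) y])) * u n w))}.
Proof.
apply: (@compensated_cvg A) => //.
- by move=> n f [phi mphi ->]; apply: measurableT_comp => //; exact: measurable_hist.
- by move=> n c; exists (fun=> c).
- move=> n psi f g mpsi [phi mphi ->] [phi' mphi' ->].
  exists (fun v => psi (phi v, phi' v)) => //.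
  by apply: measurableT_comp => //; exact: measurable_fun_pair.
- move=> n f [phi mphi ->].
  exists (fun v : n.+1.-tuple R => phi [tuple of behead v]).
    by apply: measurableT_comp => //; exact: measurable_behead.
  apply/funext => w.
  rewrite (_ : [tuple of behead (hist X n.+1 w)] = hist X n w)//.
  exact: val_inj.
- move=> n; exists (fun v : n.+1.-tuple R =>
    (hires r [tuple of behead v] (thead v))%:R) => //.
  have [] // := @bounded_measurable_bool _ (n.+1.-tuple R) R
    (fun v => hires r [tuple of behead v] (thead v)).
  by apply: measurable_hires; [exact: measurable_behead|exact: measurable_thead].
- move=> n; exists (fun v : n.-tuple R => (r (hired r v))%:R^-1) => //.
  apply: (@measurableT_comp _ _ _ _ _ _ (fun k => (r k)%:R^-1 : R)) => //.
  exact: measurable_hired.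
- by move=> n; exists (@q n).
- move=> n w; apply/andP; split; first exact: fine_ge0.
  by rewrite -lee_fin fineK ?fin_num_measure// probability_le1.
Qed.

End threshold_compensator.

(** * Compensation given the earlier decisions *)

Section rank_compensator.

(** Only finitely many patterns of length [n] occur, so every [phi] yields a bounded measurable
    function, a combination of the indicators [is_pat n a]. *)
Let A n : set (T -> R) := [set f | exists phi : seq bool -> R,
  f = fun w => phi (pattern r (hist X n w))].

Let is_pat n (a : seq bool) w : R := (pattern r (hist X n w) == a)%:R.

Let bounded_is_pat n a : bmf (is_pat n a).
Proof.
apply: bounded_measurable_bool.
apply: (@measurableT_comp _ _ _ _ _ _
  (fun v : n.-tuple R => pattern r v == a)) => //.
exact: measurable_pattern.
Qed.

Let pat_decomp n (phi : seq bool -> R) w :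
  phi (pattern r (hist X n w)) = \sum_(a : n.-tuple bool) phi a * is_pat n a w.
Proof.
have sz : size (pattern r (hist X n w)) == n by rewrite size_pattern size_past.
rewrite (bigD1 (Tuple sz))//= /is_pat eqxx mulr1 big1 ?addr0// => a.
rewrite -val_eqE /= eq_sym => /negbTE ->.
by rewrite mulr0.
Qed.

Let bounded_pat n (phi : seq bool -> R) :
  bmf (fun w => phi (pattern r (hist X n w))).
Proof.
under eq_fun do rewrite pat_decomp.
have [] // := @Rintegral_sum_bounded _ T R P _ (index_enum (n.-tuple bool))
  (fun a w => phi a * is_pat n a w).
by move=> a; apply: bounded_measurableM => //; exact: bounded_measurable_cst.
Qed.

Let p n w : R := (r (hired r (hist X n w)))%:R / n.+1%:R.

Let pat_compensates n a :
  E (fun w => is_pat n a w * acc n w) = E (fun w => is_pat n a w * p n w).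
Proof.
have := pattern_hires iidX mu_atomless (rank_leS r0 r_step) n a.
under eq_integral do rewrite -EFinM.
move=> /(congr1 fine) e; rewrite /Rintegral e.
transitivity (E (fun w => (r (count id a))%:R / n.+1%:R * is_pat n a w)).
  rewrite RintegralZl_bounded// fineM//.
  exact: (integrable_fin_num measurableT
    (bounded_measurable_integrable P (bounded_is_pat n a))).
apply: eq_Rintegral => w _; rewrite /p /is_pat mulrC hired_pattern.
by case: eqP => [->//|_]; rewrite !mul0r.
Qed.

Lemma rank_compensated_cvg : {ae P, forall w,
  cvgn (series (fun n => acc n w * u n w - n.+1%:R^-1))}.
Proof.
have : {ae P, forall w, cvgn (series (fun n => (acc n w - p n w) * u n w))}.
  apply: (@compensated_cvg A).
  - by move=> n f [phi ->]; have [] := bounded_pat n phi.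
  - by move=> n c; exists (fun=> c).
  - move=> n psi f g _ [phi ->] [phi' ->].
    by exists (fun a => psi (phi a, phi' a)).
  - by move=> n f [phi ->]; exists (fun a => phi (behead a)).
  - by move=> n; exists (fun a => (head false a)%:R).
  - move=> n; exists (fun a => (r (count id a))%:R^-1).
    by apply/funext => w; rewrite hired_pattern.
  - move=> n; exists (fun a => (r (count id a))%:R / n.+1%:R).
    by apply/funext => w; rewrite /p hired_pattern.
  - move=> n w; rewrite /p divr_ge0//= ler_pdivrMr// mul1r ler_nat.
    rewrite (leq_trans (rank_leS r0 r_step _))// ltnS.
    by rewrite (leq_trans (hired_le_size _ _))// size_past.
  - move=> n f [phi ->] _.
    under eq_Rintegral do rewrite pat_decomp mulr_suml.
    under [in RHS]eq_Rintegral do rewrite pat_decomp mulr_suml.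
    have bt g a : bmf g -> bmf (fun w => phi a * is_pat n a w * g w).
      move=> bg; apply: bounded_measurableM => //.
      by apply: bounded_measurableM => //; exact: bounded_measurable_cst.
    have bp : bmf (p n).
      have := bounded_pat n (fun a => (r (count id a))%:R / n.+1%:R).
      by under eq_fun do rewrite -hired_pattern.
    have ba := acc_bounded_measurable n.
    have [_ ->] := Rintegral_sum_bounded P (index_enum (n.-tuple bool))
      (fun a : n.-tuple bool => bt (fun w => acc n w) a ba).
    have [_ ->] := Rintegral_sum_bounded P (index_enum (n.-tuple bool))
      (fun a : n.-tuple bool => bt (p n) a bp).
    apply: eq_bigr => a _.
    under eq_Rintegral do rewrite -mulrA.
    under [in RHS]eq_Rintegral do rewrite -mulrA.
    rewrite !RintegralZl_bounded ?pat_compensates//.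
      exact: bounded_measurableM.
    exact: bounded_measurableM.
apply: filterS => w; rewrite (_ : (fun n => (acc n w - p n w) * u n w) =
  fun n => acc n w * u n w - n.+1%:R^-1)//.
(* The rank in [p] cancels against the weight, leaving the harmonic term. *)
apply/funext => n; rewrite mulrBl /p mulrAC divff ?mul1r//.
by rewrite pnatr_eq0 -lt0n rank_gt0.
Qed.

End rank_compensator.

End compensated_hires.

(** * The theorem *)

Section exponential.
Context d (T : measurableType d) (R : realType) (P : probability T R).
Variable X : {RV P >-> R}.
Hypothesis X_exp : exp1_distributed X.
Local Notation mu := (distribution P X).
Local Open Scope ereal_scope.

Lemma exp1_atomless y : mu [set y] = 0.
Proof. by rewrite X_exp// /exponential_prob integral_set1. Qed.

Lemma exp1_le0 : mu `]-oo, 0%R] = 0.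
Proof.
have neg : mu `]-oo, 0%R[ = 0.
  rewrite X_exp// /exponential_prob integral0_eq// => x /= x0.
  rewrite /exponential_pdf patchE ifF//; apply/negbTE/negP => /set_mem /=.
  by move: x0; rewrite !in_itv /= andbT => x0; rewrite leNgt x0.
rewrite -(@setUitv1 _ _ -oo%O 0%R true)//.
by apply: etrans neg; apply: measureU0 => //; exact: exp1_atomless.
Qed.

(** The rank rule and the threshold rule agree only for positive values, which carry all the
    mass. *)
Lemma exp1_eq_gt0 (A B : set R) : measurable A -> measurable B ->
  (forall y, (0 < y)%R -> A y <-> B y) -> mu A = mu B.
Proof.
have h D : measurable D -> mu D = mu (D `&` `]0%R, +oo[).
  move=> mD; rewrite (measureDI mu mD (measurable_itv `]0%R, +oo[)).
  rewrite [X in X + _](_ : _ = 0) ?add0e//.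
  apply: (subset_measure0 _ _ _ exp1_le0) => //; first exact: measurableD.
  by move=> y /= [_]; rewrite !in_itv /= andbT => /negP; rewrite -leNgt.
move=> mA mB AB; rewrite h// [RHS]h//; congr (mu _).
apply/seteqP; split => y /= [Dy y0]; split => //.
  by move: y0; rewrite in_itv /= andbT => /AB[h1 _]; exact: h1.
by move: y0; rewrite in_itv /= andbT => /AB[_ h2]; exact: h2.
Qed.

Lemma exp1_tail (A : set R) (t : R) : (0 <= t)%R -> measurable A ->
  (forall y, (0 < y)%R -> A y <-> (t < y)%R) -> mu A = (expR (- t))%:E.
Proof.
rewrite le_eqVlt => /predU1P[<-|t0] mA At.
  rewrite (@exp1_eq_gt0 A setT)// => [|y y0]; last by rewrite At.
  by rewrite probability_setT oppr0 expR0.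
rewrite (@exp1_eq_gt0 A (~` `[0%R, t]))//; last first.
  move=> y y0; rewrite At// /= in_itv /= (ltW y0) /=; split => [ty|/negP].
    by apply/negP; rewrite -ltNge.
  by rewrite -ltNge.
  exact: measurableC.
transitivity (1 - mu `[0%R, t]); first exact: probability_setC.
rewrite X_exp// exponential_prob_itv0c// mulN1r.
by rewrite -[1]/(1%R%:E) -!EFinB subKr.
Qed.

Lemma exp1_ae_gt0 : {ae P, forall w, (0 < X w)%R}.
Proof.
exists (X @^-1` `]-oo, 0%R]); split.
- exact: measurable_funPTI.
- exact: exp1_le0.
- by move=> w /= /negP; rewrite in_itv /= -leNgt.
Qed.

End exponential.

(** * Consequences of the summability assumption *)

Section ranks_from_sum.
Context (R : realType) (r : nat -> nat).
Hypothesis r0 : r 0%N = 1%N.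
Hypothesis r_step : forall m : nat, (r m <= r m.+1 <= (r m).+1)%N.
Hypothesis r_sum : (\sum_(1 <= m <oo) (((r m)%:R ^- 2 : R)%:E) < +oo)%E.

Lemma sum_inv_square_bounded :
  exists C : R, forall n, \sum_(0 <= k < n) (r k)%:R ^- 2 <= C.
Proof.
pose s := (\sum_(1 <= m <oo) (((r m)%:R ^- 2 : R)%:E))%E.
have t0 k : (0 <= ((r k)%:R ^- 2 : R)%:E)%E by rewrite lee_fin invr_ge0 exprn_ge0.
have s0 : (0 <= s)%E by apply: nneseries_ge0 => k _ _; exact: t0.
have sfin : s \is a fin_num by rewrite ge0_fin_numE.
(* The assumed series starts at index 1; the first summand accounts for index 0. *)
exists ((r 0%N)%:R ^- 2 + fine s) => -[|n].
  by rewrite big_geq// addr_ge0 ?fine_ge0// invr_ge0 exprn_ge0.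
rewrite big_nat_recl// lerD2l -lee_fin fineK//.
apply: le_trans (nneseries_lim_ge n.+1 _) => [|k _ _]; last exact: t0.
by rewrite big_add1 /= sumEFin.
Qed.

(** If the ranks stayed below [A], each term would be at least [A ^- 2] and the partial sums would
    exceed [C]; monotonicity then makes the unbounded ranks diverge. *)
Lemma rank_infty : r m @[m --> \oo] --> \oo.
Proof.
have [C rC] := sum_inv_square_bounded.
apply/cvgnyPge => A.
have [m Am] : exists m, (A <= r m)%N.
  apply: contrapT => /forallNP ub.
  have rA k : (r k <= A)%N by have := ub k; lia.
  have A1 : 0 < A%:R ^+ 2 :> R.
    by rewrite exprn_gt0// ltr0n (leq_trans _ (rA 0%N))// r0.
  have A0 : 0 < A%:R ^- 2 :> R by rewrite invr_gt0.
  pose n := (Num.truncn (C / A%:R ^- 2)).+1.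
  have C0 : 0 <= C by have := rC 0%N; rewrite big_geq.
  have nC : C < n%:R * A%:R ^- 2.
    rewrite -ltr_pdivrMr//.
    have d0 : 0 <= C / A%:R ^- 2 by rewrite divr_ge0// ltW.
    by have /andP[] := truncn_itv d0.
  have := rC n; apply/negP; rewrite -ltNge; apply: (lt_le_trans nC).
  rewrite -[n in n%:R]subn0 -sumr_const_nat mulr_suml; apply: ler_sum => k _.
  have r1 : 0 < (r k)%:R ^+ 2 :> R by rewrite exprn_gt0// ltr0n rank_gt0.
  by rewrite mul1r lef_pV2 ?posrE// ler_sqr ?nnegrE// ler_nat.
near=> k; rewrite (leq_trans Am)//; apply: (rank_nondecreasing r_step).
by near: k; exact: nbhs_infty_ge.
Unshelve. all: by end_near. Qed.

End ranks_from_sum.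

Theorem theorem4p6 (d : measure_display) (T : measurableType d) (R : realType)
  (P : probability T R)
  (r : nat -> nat)
  (r0 : r 0%N = 1%N)
  (r_step : forall m : nat, (r m <= r m.+1 <= (r m).+1)%N)
  (X W : nat -> {RV P >-> R})
  (X_exp : forall n : nat, exp1_distributed (X n))
  (W_exp : forall k : nat, (0 < k)%N -> ~~ delta r k -> exp1_distributed (W k))
  (XW_indep : mutually_independent (XW_index r) (XW X W))
  (r_sum : (\sum_(1 <= m <oo) (((r m)%:R ^- 2 : R)%:E) < +oo)%E) :
  {ae P, forall w : T,
    (hire_index r (fun n => X n w) m)%:R / lambda R r m @[m --> \oo]
      --> expR (Zvar r (fun n => X n w) (fun k => W k w))}.
Proof.
have [C rC] := sum_inv_square_bounded r_sum.
have iidX : iid (distribution P (X 0%N)) X.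
  split=> [J B uJ _ mB|n B mB]; last first.
    exact: etrans (X_exp n B mB) (esym (X_exp 0%N B mB)).
  pose B' (i : nat + nat) : set R := match i with inl n => B n | inr _ => setT end.
  have := XW_indep (map inl J) B'.
  rewrite map_inj_uniq => [|i j []//]; rewrite big_map.
  have sJ : {subset [seq inl i | i <- J] <= XW_index r}.
    by move=> i /mapP[j _ ->].
  have mB' i : measurable (B' i) by case: i => //= n; exact: mB.
  move=> /(_ uJ sJ mB') <-; congr (P _); apply/seteqP; split => w /= h i /=.
    by move=> /mapP[j jJ ->]; exact: h.
  by move=> iJ; apply: (h (inl i)); rewrite /= map_f.
have atom := exp1_atomless (X_exp 0%N).
have X0 := ae_foralln (fun n => exp1_ae_gt0 (X_exp n)).
have cT := threshold_compensated_cvg iidX r0 r_step rC.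
have cR := rank_compensated_cvg iidX atom r0 r_step rC.
move: X0 cT cR; apply: filterS3 => w x0 c2 c1.
apply: (hire_index_lambda r0 r_step (rank_infty r0 r_step r_sum) x0 c1).
(* Along a path of positive values the law of [X 0] gives the event of a hire the mass
   [expR (- T n)]. *)
rewrite (_ : (fun i => _) = fun n =>
  ((hires r (hist X n w) (X n w))%:R -
   fine (distribution P (X 0%N) [set y | hires r (hist X n w) y])) *
  (r (hired r (hist X n w)))%:R^-1)//.
apply/funext => n; congr ((_ - _) * _).
rewrite (@exp1_tail _ _ _ _ _ (X_exp 0%N) _
  (threshold r (accepted r (X ^~ w) n)))//.
- exact: threshold_accepted_ge0.
- rewrite -[X in measurable X]setTI.
  apply: (_ : measurable_fun setT (fun y => hires r (hist X n w) y)) => //.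
  exact: measurable_hires.
- by move=> y y0 /=; rewrite hires_threshold.
Qed.
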